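(* For each $n$ let $\hat X^n$ be the diffusion-scaled state process of the N-network under the state-dependent priority Markov scheduling policy $\check z^n$, and let $\widehat{\mathcal L}_n^{\check z^n}$ be its generator. For any $k\ge2$ there exists $\beta_0>0$ such that for every $\beta\ge\beta_0$ there are positive constants $C_1,C_2$ and $n_0\in\mathbb N$, depending on $\beta$ and $k$, such that $$\widehat{\mathcal L}_n^{\check z^n}\mathcal V_{k,\beta}(\hat x)\;\le\;C_1-C_2\,\mathcal V_{k,\beta}(\hat x)\qquad\forall\,\hat x\in\mathcal S^n,\ \forall\,n\ge n_0 .$$ Namely, $\hat X^n$ under $\check z^n$ is geometrically ergodic. As a consequence, for any $k>0$ there exists $n_0\in\mathbb N$ such that $$\sup_{n\ge n_0}\;\limsup_{T\to\infty}\;\frac1T\,\mathbb E^{\check z^n}\left[\int_0^T|\hat X^n(s)|^k\,ds\right]<\infty ,$$ and the same holds if $\hat X^n$ is replaced by $\hat Q^n$ or $\hat Y^n$. In other words, the diffusion-scaled cost $J(\hat X^n(0),\check z^n)$ is finite for $n\ge n_0$.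
   Context: **Notation.** $a\wedge b=\min(a,b)$, $a^+=\max(a,0)$; $e_1=(1,0)$, $e_2=(0,1)$; $|\cdot|$ is the Euclidean norm. **N-network.** For each $n\in\mathbb N$ there are two customer classes $i=1,2$ and two server pools $j=1,2$ with $N_j^n$ identical servers in pool $j$. Pool 1 serves only class 1; pool 2 serves both classes. Class-$i$ jobs arrive as a Poisson process of rate $\lambda_i^n$; class-1 jobs are served at exponential rates $\mu_{11}^n,\mu_{12}^n$ in pools 1, 2, class-2 jobs at exponential rate $\mu_{22}^n$ in pool 2; waiting class-$i$ jobs abandon at exponential rate $\gamma_i^n$. Standing assumption: as $n\to\infty$, for $i,j\in\{1,2\}$, $\lambda_i^n/n\to\lambda_i>0$, $(\lambda_i^n-n\lambda_i)/\sqrt n\to\hat\lambda_i$, $\gamma_i^n\to\gamma_i\ge0$, $N_j^n/n\to\nu_j>0$, $\sqrt n(n^{-1}N_j^n-\nu_j)\to0$; for $(i,j)\in\{(1,1),(1,2),(2,2)\}$, $\mu_{ij}^n\to\mu_{ij}>0$, $\sqrt n(\mu_{ij}^n-\mu_{ij})\to\hat\mu_{ij}$; and $\lambda_1>\mu_{11}\nu_1$, $\frac{\lambda_1-\mu_{11}\nu_1}{\mu_{12}\nu_2}+\frac{\lambda_2}{\mu_{22}\nu_2}=1$. Put $\xi^*_{12}=\frac{\lambda_1-\mu_{11}\nu_1}{\mu_{12}\nu_2}$, $\xi^*_{22}=\frac{\lambda_2}{\mu_{22}\nu_2}$, $x_1^*=\nu_1+\xi^*_{12}\nu_2$, $x_2^*=\xi_{22}^*\nu_2$.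 **The policy $\check z^n$.** Let $N_{12}^n=\lfloor\xi_{12}^*N_2^n\rfloor$, $N_{22}^n=\lceil\xi_{22}^*N_2^n\rceil$, so $N_{12}^n+N_{22}^n=N_2^n$. For $x\in\mathbb Z_+^2$ ($x_i$ = number of class-$i$ jobs in the system), the numbers $\check z^n_{ij}(x)$ of class-$i$ jobs in service in pool $j$ are $\check z_{11}^n(x)=x_1\wedge N_1^n$; $\check z_{12}^n(x)=(x_1-N_1^n)^+\wedge N_{12}^n$ if $x_2\ge N_{22}^n$, and $(x_1-N_1^n)^+\wedge(N_2^n-x_2)$ otherwise; $\check z_{22}^n(x)=x_2\wedge N_{22}^n$ if $x_1\ge N_1^n+N_{12}^n$, and $x_2\wedge(N_2^n-(x_1-N_1^n)^+)$ otherwise; $\check z^n_{21}=0$. The queue lengths and idle servers are $\check q_1^n=x_1-\check z_{11}^n-\check z_{12}^n$, $\check q_2^n=x_2-\check z_{22}^n$, $\check y_1^n=N_1^n-\check z_{11}^n$, $\check y_2^n=N_2^n-\check z_{12}^n-\check z_{22}^n$. **Generators and scaling.** Under $\check z^n$ the state process $X^n$ (numbers of jobs of each class in the system) is the Markov chain on $\mathbb Z_+^2$ with generator $\mathcal L_n^{\check z^n}f(x)=\sum_{i=1}^2\lambda_i^n(f(x+e_i)-f(x))+(\mu_{11}^n\check z_{11}^n+\mu_{12}^n\check z_{12}^n)(f(x-e_1)-f(x))+\mu_{22}^n\check z_{22}^n(f(x-e_2)-f(x))+\sum_{i=1}^2\gamma_i^n\check q_i^n(f(x-e_i)-f(x))$.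 Let $\hat x^n(x)=n^{-1/2}(x-nx^* )$, $\mathcal S^n=\{\hat x^n(x):x\in\mathbb Z_+^2\}$, $\hat X^n=\hat x^n(X^n)$, $\hat Q_i^n=n^{-1/2}\check q_i^n(X^n)$, $\hat Y_j^n=n^{-1/2}\check y_j^n(X^n)$; the generator of $\hat X^n$ is $\widehat{\mathcal L}_n^{\check z^n}f(\hat x)=\mathcal L_n^{\check z^n}(f\circ\hat x^n)(x)$ for $\hat x=\hat x^n(x)$. The initial conditions $\hat X^n(0)$ are deterministic and converge as $n\to\infty$. **Lyapunov function and cost.** $\mathcal V_{k,\beta}(x)=|x_1|^k+\beta|x_2|^k$, $x\in\mathbb R^2$. With $m\ge1$, $\xi\in(0,\infty)^2$, $\zeta\in[0,\infty)^2$ fixed, $J(\hat X^n(0),\check z^n)=\limsup_{T\to\infty}\frac1T\mathbb E^{\check z^n}\int_0^T\big[\sum_i\xi_i(\hat Q_i^n(s))^m+\sum_j\zeta_j(\hat Y_j^n(s))^m\big]ds$.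
   Formalization: The limiting abandonment rates are assumed strictly positive, γ_1>0 and γ_2>0, instead of γ_i≥0; if either limit is 0, the drift inequality with constants uniform in n fails (let that class's queue tend to infinity), so the claim is false there. *)

(* Defs.v *)
From HB Require Import structures.
From mathcomp Require Import all_boot all_order all_algebra.
From mathcomp Require Import all_classical all_reals all_analysis.

Set Implicit Arguments.
Unset Strict Implicit.
Unset Printing Implicit Defensive.

Import Order.TTheory GRing.Theory Num.Theory.
Import numFieldNormedType.Exports.

Local Open Scope classical_set_scope.
Local Open Scope ring_scope.

(* The product sigma-algebra on nat * nat is the discrete one. *)
Definition state : Type := (nat * nat)%type.

Section network.
Context {R : realType}.

Record network := Network {
  lam1 : nat -> R;  lam2 : nat -> R;
  mu11 : nat -> R;  mu12 : nat -> R;  mu22 : nat -> R;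
  gam1 : nat -> R;  gam2 : nat -> R;
  srv1 : nat -> nat;  srv2 : nat -> nat
}.

(* The prefix h marks the diffusion-scale limits, e.g. hlam1 is the limit of
   (lam1 n - n llam1) / sqrt n. *)
Record limits := Limits {
  llam1 : R;  llam2 : R;
  lmu11 : R;  lmu12 : R;  lmu22 : R;
  lgam1 : R;  lgam2 : R;
  nu1 : R;  nu2 : R;
  hlam1 : R;  hlam2 : R;
  hmu11 : R;  hmu12 : R;  hmu22 : R
}.

Definition xi12 (L : limits) : R :=
  (llam1 L - lmu11 L * nu1 L) / (lmu12 L * nu2 L).
Definition xi22 (L : limits) : R := llam2 L / (lmu22 L * nu2 L).
Definition xstar (L : limits) : R * R :=
  (nu1 L + xi12 L * nu2 L, xi22 L * nu2 L).

Definition rates_ge0 (a : network) : Prop := forall n,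
  [/\ 0 <= lam1 a n, 0 <= lam2 a n, 0 <= gam1 a n & 0 <= gam2 a n] /\
  [/\ 0 <= mu11 a n, 0 <= mu12 a n & 0 <= mu22 a n].

Definition arrival_limit (lam : nat -> R) (l hl : R) : Prop :=
  [/\ (lam n / n%:R) @[n --> \oo] --> l, 0 < l &
      ((lam n - n%:R * l) / Num.sqrt n%:R) @[n --> \oo] --> hl].

Definition service_limit (mu : nat -> R) (l hl : R) : Prop :=
  [/\ mu n @[n --> \oo] --> l, 0 < l &
      (Num.sqrt n%:R * (mu n - l)) @[n --> \oo] --> hl].

Definition abandonment_limit (gam : nat -> R) (l : R) : Prop :=
  gam n @[n --> \oo] --> l /\ 0 <= l.

Definition server_limit (srv : nat -> nat) (nu : R) : Prop :=
  [/\ ((srv n)%:R / n%:R : R) @[n --> \oo] --> nu, 0 < nu &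
      (Num.sqrt n%:R * ((srv n)%:R / n%:R - nu)) @[n --> \oo] --> (0 : R)].

Record halfin_whitt (a : network) (L : limits) : Prop := HalfinWhitt {
  hw_rates : rates_ge0 a;
  hw_lam1 : arrival_limit (lam1 a) (llam1 L) (hlam1 L);
  hw_lam2 : arrival_limit (lam2 a) (llam2 L) (hlam2 L);
  hw_gam1 : abandonment_limit (gam1 a) (lgam1 L);
  hw_gam2 : abandonment_limit (gam2 a) (lgam2 L);
  hw_srv1 : server_limit (srv1 a) (nu1 L);
  hw_srv2 : server_limit (srv2 a) (nu2 L);
  hw_mu11 : service_limit (mu11 a) (lmu11 L) (hmu11 L);
  hw_mu12 : service_limit (mu12 a) (lmu12 L) (hmu12 L);
  hw_mu22 : service_limit (mu22 a) (lmu22 L) (hmu22 L);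
  hw_overload : lmu11 L * nu1 L < llam1 L;
  hw_critical : xi12 L + xi22 L = 1
}.

Section policy.
Variables (a : network) (L : limits) (n : nat).

(* Under halfin_whitt both arguments of `|_| are nonnegative integers. *)
Definition srv12 : nat := `|Num.floor (xi12 L * (srv2 a n)%:R)|%N.
Definition srv22 : nat := `|Num.ceil (xi22 L * (srv2 a n)%:R)|%N.

(* Truncated subtraction on nat is (x_1 - N_1)^+; every other subtraction
   below has a nonnegative exact value, as srv12 + srv22 = srv2 a n. *)
Definition z11 (x : state) : nat := minn x.1 (srv1 a n).
Definition z12 (x : state) : nat :=
  if (srv22 <= x.2)%N then minn (x.1 - srv1 a n) srv12
  else minn (x.1 - srv1 a n) (srv2 a n - x.2).
Definition z22 (x : state) : nat :=
  if (srv1 a n + srv12 <= x.1)%N then minn x.2 srv22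
  else minn x.2 (srv2 a n - (x.1 - srv1 a n)).

Definition q1 (x : state) : nat := (x.1 - z11 x - z12 x)%N.
Definition q2 (x : state) : nat := (x.2 - z22 x)%N.
Definition y1 (x : state) : nat := (srv1 a n - z11 x)%N.
Definition y2 (x : state) : nat := (srv2 a n - z12 x - z22 x)%N.

(* When x_i = 0 all the rates multiplying f (x - e_i) - f x vanish, so the
   value 0.-1 = 0 is immaterial. *)
Definition gen (f : state -> R) (x : state) : R :=
  lam1 a n * (f (x.1.+1, x.2) - f x) + lam2 a n * (f (x.1, x.2.+1) - f x)
  + (mu11 a n * (z11 x)%:R + mu12 a n * (z12 x)%:R)
    * (f (x.1.-1, x.2) - f x)
  + mu22 a n * (z22 x)%:R * (f (x.1, x.2.-1) - f x)
  + gam1 a n * (q1 x)%:R * (f (x.1.-1, x.2) - f x)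
  + gam2 a n * (q2 x)%:R * (f (x.1, x.2.-1) - f x).

Definition xhat (x : state) : R * R :=
  ((x.1%:R - n%:R * (xstar L).1) / Num.sqrt n%:R,
   (x.2%:R - n%:R * (xstar L).2) / Num.sqrt n%:R).
Definition qhat (x : state) : R * R :=
  ((q1 x)%:R / Num.sqrt n%:R, (q2 x)%:R / Num.sqrt n%:R).
Definition yhat (x : state) : R * R :=
  ((y1 x)%:R / Num.sqrt n%:R, (y2 x)%:R / Num.sqrt n%:R).

(* The generator of the scaled process, evaluated at xhat x. *)
Definition genhat (f : R * R -> R) (x : state) : R := gen (f \o xhat) x.

End policy.

Definition lyap (k beta : R) (x : R * R) : R :=
  `|x.1| `^ k + beta * `|x.2| `^ k.

Definition enorm (x : R * R) : R := Num.sqrt (x.1 ^+ 2 + x.2 ^+ 2).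

(* p t x is the law at time t of the chain started at x; only t >= 0 matters.
   As A will be a conservative Q-matrix with finitely many nonzero entries per
   row, ts_generator says the same as the usual P_x(X_h = y) = 1_{x = y} +
   A_{xy} h + o(h). *)
Record transition_semigroup (A : (state -> R) -> state -> R)
    (p : R -> R.-pker state ~> state) : Prop := TransitionSemigroup {
  ts_initial : forall (x : state) (B : set state), measurable B -> p 0 x B = \d_x B;
  ts_chapman_kolmogorov : forall s t : R, 0 <= s -> 0 <= t ->
    forall (x : state) (B : set state), measurable B ->
      p (s + t) x B = (\int[p s x]_y p t y B)%E;
  ts_generator : forall f : state -> R,
    (exists M : R, forall x, `|f x| <= M) ->
    forall x, (h^-1 * ((\int[p h x]_y f y)%R - f x)) @[h --> 0^'+] --> A f x
}.

Definition past_events (T : Type) (X : R -> T -> state) (s : R) :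
    set (set T) :=
  [set E | exists (u : R) (B : set state),
    [/\ 0 <= u, u <= s, measurable B & E = X u @^-1` B]].

(* Time-homogeneous Markov process for its natural filtration, with transition
   semigroup p and piecewise constant cadlag paths; only times >= 0 matter. *)
Record markov_process (p : R -> R.-pker state ~> state)
    (d : measure_display) (T : measurableType d) (P : probability T R)
    (X : R -> T -> state) : Prop := MarkovProcess {
  mp_measurable : forall t : R, 0 <= t -> measurable_fun setT (X t);
  mp_right_continuous : forall (w : T) (t : R), 0 <= t ->
    \forall u \near t^'+, X u w = X t w;
  mp_left_limit : forall (w : T) (t : R), 0 < t ->
    exists y, \forall u \near t^'-, X u w = y;
  mp_markov : forall s t : R, 0 <= s -> 0 <= t ->
    forall E : set T, <<s past_events X s >> E ->
    forall B : set state, measurable B ->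
      P (E `&` X (s + t) @^-1` B) = (\int[P]_(w in E) p t (X s w) B)%E
}.

(* Exponential convergence in total variation to an invariant probability.
   On Z_+^2 or on its image under the injection xhat (n > 0) this is the
   same property. *)
Definition geometrically_ergodic (p : R -> R.-pker state ~> state) : Prop :=
  exists (pi : probability state R) (M : state -> R) (rho : R),
    [/\ 0 < rho,
        forall (t : R) (B : set state), 0 <= t -> measurable B ->
          (\int[pi]_x p t x B)%E = pi B &
        forall (t : R) (x : state) (B : set state), 0 <= t -> measurable B ->
          (`|p t x B - pi B| <= (M x * expR (- rho * t))%:E)%E].

(* limsup_{S -> oo} S^-1 E [ \int_0^S g s ds ], in [0, +oo] for g >= 0. *)
Definition ergodic_mean (d : measure_display) (T : measurableType d)
    (P : probability T R) (g : R -> T -> R) : \bar R :=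
  limf_esup (fun S : R =>
    (S^-1)%:E *
      \int[P]_w \int[@lebesgue_measure R]_(s in `[0%R, S]) (g s w)%:E)%E
    (pinfty_nbhs R).

Definition running_cost (m : R) (xi zeta : R * R) (q y : R * R) : R :=
  xi.1 * q.1 `^ m + xi.2 * q.2 `^ m + (zeta.1 * y.1 `^ m + zeta.2 * y.2 `^ m).

End network.

Arguments network R : clear implicits.
Arguments limits R : clear implicits.

(* Main.v *)
Require Import Defs.
From HB Require Import structures.
From mathcomp Require Import all_boot all_order all_algebra.
From mathcomp Require Import all_classical all_reals all_analysis.
From mathcomp Require Import measurable_realfun.
From mathcomp Require Import ring lra zify.

(** The argument has three layers.

    Drift. Under this policy the two classes decouple at the level of drift.
    All the departures of class i, in service or by abandonment, can be compared
    with the departures at the reference staffing (N1 + N12 servers for class 1,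
    N22 for class 2), and the deviations of the individual allocations and of
    the queue from this reference always have a common sign, that of
    x_i - staffing_i ([class1_split], [class2_split]). Since the service and
    abandonment rates lie in a fixed interval [c, K] with c > 0, the drift of
    class i is restoring with a slope at least c, up to an error O(sqrt n), which
    is the scale of the Halfin-Whitt fluctuations ([regime_near],
    [restoring_force]). On a function |.|^k this linear restoring force beats the second-order term, which grows
    one power slower ([norm_powR_step], [birth_death_drift]). This gives the
    drift inequality for any beta > 0 ([lyapunov_drift]).

    Semigroup. The generator is the derivative of p_t on bounded functions only,
    hence the drift inequality for the unbounded V takes care to integrate. For
    bounded f the function p_t f solves the backward equation pointwise, from the right;
    e^(-C2 t) (V - C1/C2) + C1/C2 is a supersolution, and a comparison principle
    for the two, based on the minimum principle at the finitely many states
    where V is small, gives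
      p_t f <= e^(-C2 t) V + C1 / C2   for every bounded f <= V
    ([Et_drift]). Geometric ergodicity is then Harris' theorem: the empty system
    is reached with positive probability from everywhere ([hit_empty_gt0]), so
    that on a sublevel set of V a fixed mass is put on it; the oscillation of
    p_t f, measured against 1 + b V around a constant, contracts geometrically.
    The values p_t(x, B) converge uniformly in B, which makes the limit an
    invariant probability ([uniform_limit_probability],
    [harris_geometrically_ergodic]).

    Time averages. Right-continuity of the paths gives joint measurability in
    time and chance ([path_measurable]); by Tonelli's theorem the time averages
    are averages of the moments p_t g (x0), and these are at most
    G (1 + V(x0) + C1 / C2) whenever g <= G (1 + V) ([moment_bound]). Queues and
    idle servers are O(1 + |xhat|) ([queue_idle_growth]) and the scaled initial
    states are bounded, hence all bounds are uniform in n. *)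

Set Implicit Arguments.
Unset Strict Implicit.
Unset Printing Implicit Defensive.

Import Order.TTheory GRing.Theory Num.Theory.
Import numFieldNormedType.Exports.

Local Open Scope classical_set_scope.
Local Open Scope ring_scope.

(** * Power functions *)

(** The tangent line of the convex function t^k lies below it; this is Young's
    inequality for the exponents k and k / (k - 1). *)
Lemma powR_tangent (R : realType) (k a b : R) : 1 <= k -> 0 <= a -> 0 <= b ->
  a `^ k - b `^ k <= k * a `^ (k - 1) * (a - b).
Proof.
move=> k1 a0 b0.
have [->|kN1] := eqVneq k 1; first by rewrite subrr powRr0 !powRr1// mul1r mul1r.
have k1' : 1 < k by rewrite lt_neqAle eq_sym kN1.
have k0 : 0 < k by lra.
have km0 : 0 < k - 1 by lra.
have kn : k != 0 by rewrite gt_eqF.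
have kmn : k - 1 != 0 by rewrite gt_eqF.
have := @conjugate_powR R b (a `^ (k - 1)) k (k / (k - 1)) b0 (powR_ge0 _ _) k0.
have -> : (a `^ (k - 1)) `^ (k / (k - 1)) = a `^ k.
  by rewrite -powRrM; congr (_ `^ _); field; by rewrite ?kn ?kmn.
have <- : a * a `^ (k - 1) = a `^ k by apply: mulr_powRB1.
move=> /(_ (divr_gt0 k0 km0)) H.
have {}H : b * a `^ (k - 1) <= b `^ k / k + a * a `^ (k - 1) / (k / (k - 1)).
  by apply: H; field; by rewrite ?kn ?kmn.
have {}H : k * (b * a `^ (k - 1)) <= b `^ k + (k - 1) * (a * a `^ (k - 1)).
  rewrite -(ler_pM2l k0) in H; apply: (le_trans H).
  by rewrite le_eqVlt; apply/orP; left; apply/eqP; field; by rewrite ?kn ?kmn.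
nra.
Qed.

Lemma powR_monotone_gap (R : realType) (k a b M : R) : 1 <= k -> 0 <= a <= M ->
  0 <= b <= M ->
  (a `^ k - b `^ k) * (a - b) <= k * M `^ (k - 1) * (a - b) ^+ 2.
Proof.
move=> k1; wlog ab : a b / b <= a.
  move=> H ha hb; have [ab|/ltW ab] := leP b a; first exact: H.
  rewrite -mulrNN !opprB -[(a - b) ^+ 2]sqrrN opprB; exact: H.
move=> /andP[a0 aM] /andP[b0 bM]; rewrite expr2 mulrA.
apply: ler_wpM2r; first by rewrite subr_ge0.
apply: (le_trans (powR_tangent _ _ _)) => //.
apply: ler_wpM2r; first by rewrite subr_ge0.
apply: ler_wpM2l; first lra.
by apply: ge0_ler_powR => //; rewrite ?nnegrE; lra.
Qed.

(** A second-order upper bound for |.|^k around y, uniform in the step h.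
    Convexity replaces Taylor's formula, so that no derivative of |.|^k and no
    discussion of the sign change at the origin is needed. *)
Lemma norm_powR_step (R : realType) (k y h : R) : 2 <= k -> `|h| <= 1 ->
  `|y + h| `^ k - `|y| `^ k
    <= k * `|y| `^ (k - 2) * (y * h) + k ^+ 2 * (1 + `|y|) `^ (k - 2) * h ^+ 2.
Proof.
move=> k2 h1.
set a := `|y + h|; set b := `|y|.
have a0 : 0 <= a by apply: normr_ge0.
have b0 : 0 <= b by apply: normr_ge0.
have aM : a <= 1 + b by rewrite /a /b (le_trans (ler_normD _ _))// addrC lerD2r.
have dh : (a - b) ^+ 2 <= h ^+ 2.
  rewrite -(real_normK (num_real (a - b))) -(real_normK (num_real h)).
  rewrite lerXn2r ?nnegrE// /a /b.
  by rewrite (le_trans (ler_dist_dist _ _))// addrC addKr.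
have bab : b * (a - b) <= y * h + h ^+ 2.
  rewrite mulrBr /a /b -normrM -normrM.
  have [h0|h0] := leP 0 (y * (y + h)).
    by rewrite ger0_norm// (ger0_norm (sqr_ge0 y)); nra.
  by rewrite ltr0_norm// (ger0_norm (sqr_ge0 y)); nra.
have k1 : 1 <= k by lra.
have km1 : 1 <= k - 1 by lra.
have T1 := powR_tangent k1 a0 b0.
have T2 : (a `^ (k - 1) - b `^ (k - 1)) * (a - b)
    <= (k - 1) * (1 + b) `^ (k - 2) * h ^+ 2.
  have := @powR_monotone_gap R (k - 1) a b (1 + b) km1.
  rewrite (_ : k - 1 - 1 = k - 2); last by ring.
  rewrite a0 aM b0 (_ : b <= 1 + b); last by lra.
  move=> /(_ isT isT) /le_trans; apply; apply: ler_wpM2l => //.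
  by apply: mulr_ge0; [lra|apply: powR_ge0].
have bE : b `^ (k - 1) = b * b `^ (k - 2).
  rewrite -(@mulr_powRB1 _ b (k - 1))//; last by lra.
  by congr (_ * _ `^ _); ring.
set B := b `^ (k - 2); set M := (1 + b) `^ (k - 2).
rewrite -/B -/M in bE T2.
have B0 : 0 <= B by apply: powR_ge0.
have BM : B <= M.
  by apply: ge0_ler_powR; rewrite ?nnegrE; lra.
have T3 : b `^ (k - 1) * (a - b) <= B * (y * h) + M * h ^+ 2.
  rewrite bE mulrAC mulrC; apply: (le_trans (ler_wpM2l B0 bab)).
  by rewrite mulrDr lerD2l ler_wpM2r// sqr_ge0.
apply: (le_trans T1).
have -> : k * a `^ (k - 1) * (a - b) = k * (b `^ (k - 1) * (a - b)
  + (a `^ (k - 1) - b `^ (k - 1)) * (a - b)) by ring.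
have k0 : 0 <= k by lra.
apply: (le_trans (ler_wpM2l k0 (lerD T3 T2))).
by rewrite le_eqVlt; apply/orP; left; apply/eqP; ring.
Qed.

Lemma powR_add_le (R : realType) (k r s : R) : 0 <= k -> 0 <= r -> 0 <= s ->
  (r + s) `^ k <= 2 `^ k * (r `^ k + s `^ k).
Proof.
move=> k0; wlog rs : r s / r <= s.
  move=> H r0 s0; have [|/ltW] := leP r s => rs; first exact: H.
  by rewrite (addrC r) (addrC (r `^ k)); exact: H.
move=> r0 s0; apply: (@le_trans _ _ ((2 * s) `^ k)).
  by apply: ge0_ler_powR; rewrite ?nnegrE//; lra.
by rewrite powRM// ler_wpM2l ?powR_ge0// lerDr powR_ge0.
Qed.

(** A lower power is negligible: it is bounded while 1 + r <= Q, and
    beyond that one power is gained; the level Q is such that C 2^k <= c Q. *)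
Lemma powR_absorb (R : realType) (k C c : R) : 1 <= k -> 0 <= C -> 0 < c ->
  exists2 C1 : R, 0 < C1 &
    forall r, 0 <= r -> C * (1 + r) `^ (k - 1) <= C1 + c * r `^ k.
Proof.
move=> k1 C0 c0; set Q := 1 + C * 2 `^ k / c.
have Q1 : 1 <= Q by rewrite lerDl divr_ge0 ?mulr_ge0 ?powR_ge0// ltW.
exists (C * Q `^ (k - 1) + c).
  by rewrite ltr_wpDl// mulr_ge0// powR_ge0.
move=> r r0; have [rQ|rQ] := leP (1 + r) Q.
  rewrite -addrA ler_wpDr//.
    by rewrite addr_ge0 ?(ltW c0)// mulr_ge0 ?(ltW c0)// powR_ge0.
  by apply: ler_wpM2l => //; apply: ge0_ler_powR; rewrite ?nnegrE; lra.
have h : C * (1 + r) `^ k <= c * Q * (1 + r `^ k).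
  have := @powR_add_le R k 1 r; rewrite powR1 => H.
  have {}H : (1 + r) `^ k <= 2 `^ k * (1 + r `^ k) by apply: H; lra.
  apply: (le_trans (ler_wpM2l C0 H)); rewrite mulrA ler_wpM2r//.
    by rewrite addr_ge0// powR_ge0.
  rewrite /Q mulrDr mulr1 [c * (_ / _)]mulrC divfK ?gt_eqF//.
  by rewrite lerDr ltW.
have Q0 : 0 < Q by lra.
have h2 : Q * (C * (1 + r) `^ (k - 1)) <= C * (1 + r) `^ k.
  rewrite -(@mulr_powRB1 _ (1 + r) k); [|lra|lra].
  rewrite mulrCA ler_wpM2l// ler_wpM2r ?powR_ge0//; lra.
have h3 : C * (1 + r) `^ (k - 1) <= c * (1 + r `^ k).
  by rewrite -(ler_pM2l Q0) (le_trans h2)// (le_trans h)// mulrA (mulrC c).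
have : 0 <= C * Q `^ (k - 1) by rewrite mulr_ge0 ?powR_ge0.
lra.
Qed.

(** A birth-death step of size s and rates rp, rm, read through |.|^k: a
    restoring drift (rp - rm) s towards the origin beats the second-order term
    as soon as the variance (rp + rm) s^2 grows at most linearly. *)
Lemma birth_death_drift (R : realType) (k K c : R) :
  2 <= k -> 0 <= K -> 0 < c ->
  exists2 C1 : R, 0 < C1 & forall y rp rm s, 0 <= rp -> 0 <= rm -> 0 <= s <= 1 ->
    y * ((rp - rm) * s) <= K * `|y| - c * y ^+ 2 ->
    (rp + rm) * s ^+ 2 <= K * (1 + `|y|) ->
    rp * (`|y + s| `^ k - `|y| `^ k) + rm * (`|y - s| `^ k - `|y| `^ k)
      <= C1 - c * `|y| `^ k.
Proof.
move=> k2 K0 c0; have k1 : 1 <= k by lra.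
have kc0 : 0 < (k - 1) * c by apply: mulr_gt0 => //; lra.
have C'0 : 0 <= k * K + k ^+ 2 * K.
  by apply: addr_ge0; apply: mulr_ge0 => //; [lra|exact: sqr_ge0].
have [C1 C10 HC1] := powR_absorb k1 C'0 kc0.
exists C1 => // y rp rm s rp0 rm0 /andP[s0 s1] hd hv.
have hs : `|s| <= 1 by rewrite ger0_norm.
have hs' : `|- s| <= 1 by rewrite normrN.
have S1 := ler_wpM2l rp0 (norm_powR_step y k2 hs).
have S2 := ler_wpM2l rm0 (norm_powR_step y k2 hs').
apply: (le_trans (lerD S1 S2)).
have := HC1 `|y| (normr_ge0 _).
set b := `|y| in hv hd *; set B := b `^ (k - 2); set M := (1 + b) `^ (k - 2).
have b0 : 0 <= b by apply: normr_ge0.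
have B0 : 0 <= B by apply: powR_ge0.
have M0 : 0 <= M by apply: powR_ge0.
have BM : B <= M by apply: ge0_ler_powR; rewrite ?nnegrE; lra.
have -> : (1 + b) `^ (k - 1) = (1 + b) * M.
  rewrite -(@mulr_powRB1 _ (1 + b) (k - 1)); [|lra|lra].
  by congr (_ * _ `^ _); ring.
have bk : b `^ k = B * y ^+ 2.
  rewrite -(@mulr_powRB1 _ b k)//; last lra.
  rewrite -(@mulr_powRB1 _ b (k - 1))//; last lra.
  rewrite -[y ^+ 2]real_normK ?num_real// -/b /B.
  have -> : k - 1 - 1 = k - 2 by ring.
  ring.
rewrite bk => H; move: S1 S2 HC1 => _ _ _.
have k0 : 0 <= k by lra.
have T1 := ler_wpM2l (mulr_ge0 k0 B0) hd.
have T2 := ler_wpM2l (mulr_ge0 (sqr_ge0 k) M0) hv.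
have T3 : B * b <= (1 + b) * M.
  by rewrite mulrC; apply: ler_pM => //; lra.
have T4 := ler_wpM2l (mulr_ge0 k0 K0) T3.
rewrite sqrrN; lra.
Qed.

(** * The policy near the reference staffing *)

(** All jobs of class 1 are in service or in queue, and the three deviations
    z11 - N1, z12 - N12, q1 from the reference allocation have a common sign.
    This is what makes the class-1 drift restoring whatever class 2 does. *)
Lemma class1_split (R : realType) (a : network R) (L : limits R) n (x : state) :
  (srv12 a L n + srv22 a L n = srv2 a n)%N ->
  (z11 a n x + z12 a L n x + q1 a L n x = x.1)%N /\
  ([/\ z11 a n x <= srv1 a n, z12 a L n x <= srv12 a L n & q1 a L n x = 0]%N \/
   (srv1 a n <= z11 a n x /\ srv12 a L n <= z12 a L n x)%N).
Proof.
rewrite /q1 /z11 /z12.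
move: (srv12 a L n) (srv22 a L n) (srv2 a n) (srv1 a n) => N12 N22 N2 N1 <-.
case: x => x1 x2 /=; case: (leqP N22 x2) => h2; last first.
  by split; [lia|case: (leqP (N1 + N12) x1) => h1; [right|left]; split; lia].
by split; [lia|case: (leqP (N1 + N12) x1) => h1; [right|left]; split; lia].
Qed.

Lemma class2_split (R : realType) (a : network R) (L : limits R) n (x : state) :
  (srv12 a L n + srv22 a L n = srv2 a n)%N ->
  (z22 a L n x + q2 a L n x = x.2)%N /\
  ((z22 a L n x <= srv22 a L n)%N /\ q2 a L n x = 0%N \/
   (srv22 a L n <= z22 a L n x)%N).
Proof.
rewrite /q2 /z22.
move: (srv12 a L n) (srv22 a L n) (srv2 a n) (srv1 a n) => N12 N22 N2 N1 <-.
case: x => x1 x2 /=; case: (leqP (N1 + N12) x1) => h1; last first.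
  by split; [lia|case: (leqP N22 x2) => h2; [right|left; split]; lia].
by split; [lia|case: (leqP N22 x2) => h2; [right|left; split]; lia].
Qed.

(** Class i queues only above its staffing level, and servers idle only if some
    class is below its own. *)
Lemma queues_idle_le (R : realType) (a : network R) (L : limits R) n (x : state) :
  (srv12 a L n + srv22 a L n = srv2 a n)%N ->
  [/\ q1 a L n x <= x.1 - (srv1 a n + srv12 a L n),
      q2 a L n x <= x.2 - srv22 a L n,
      y1 a n x <= srv1 a n + srv12 a L n - x.1 &
      y2 a L n x <= (srv1 a n + srv12 a L n - x.1) + (srv22 a L n - x.2)]%N.
Proof.
rewrite /q1 /q2 /y1 /y2 /z11 /z12 /z22.
move: (srv12 a L n) (srv22 a L n) (srv2 a n) (srv1 a n) => N12 N22 N2 N1 <-.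
case: x => x1 x2 /=.
by case: (leqP (N1 + N12) x1) => h1; case: (leqP N22 x2) => h2; split; lia.
Qed.

(** The finite-n consequences of the Halfin-Whitt limits: every rate is
    bounded and bounded away from 0, and the staffing levels N1 + N12, N22
    as well as the net input at full staffing are within O(sqrt n) of their
    fluid values. *)
Record regime (R : realType) (a : network R) (L : limits R) (c K : R)
    (n : nat) : Prop := Regime {
  rg_n : (0 < n)%N;
  rg_pools : (srv12 a L n + srv22 a L n = srv2 a n)%N;
  rg_lam1 : 0 <= lam1 a n <= K * n%:R;
  rg_lam2 : 0 <= lam2 a n <= K * n%:R;
  rg_gam1 : c <= gam1 a n <= K;
  rg_gam2 : c <= gam2 a n <= K;
  rg_mu11 : c <= mu11 a n <= K;
  rg_mu12 : c <= mu12 a n <= K;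
  rg_mu22 : c <= mu22 a n <= K;
  rg_fluid : `|(xstar L).1| <= K /\ `|(xstar L).2| <= K;
  rg_stf1 : `|(srv1 a n + srv12 a L n)%:R - n%:R * (xstar L).1|
              <= K * Num.sqrt n%:R;
  rg_stf2 : `|(srv22 a L n)%:R - n%:R * (xstar L).2| <= K * Num.sqrt n%:R;
  rg_net1 : `|lam1 a n - mu11 a n * (srv1 a n)%:R
              - mu12 a n * (srv12 a L n)%:R| <= K * Num.sqrt n%:R;
  rg_net2 : `|lam2 a n - mu22 a n * (srv22 a L n)%:R| <= K * Num.sqrt n%:R
}.

Lemma cvg_norm_bounded (R : realType) (u : nat -> R) (l : R) :
  u n @[n --> \oo] --> l ->
  exists2 M : R, 0 <= M & \forall n \near \oo, `|u n| <= M.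
Proof.
move=> ul; exists (`|l| + 1); first by rewrite addr_ge0.
by apply: (cvgr_norm_le l ul); rewrite ltrDl.
Qed.

Lemma service_limit_bounds (R : realType) (mu : nat -> R) l hl :
  service_limit mu l hl -> exists2 M : R, 0 <= M &
  \forall n \near \oo, [/\ l / 2 <= mu n <= M &
     n%:R * `|mu n - l| <= M * Num.sqrt n%:R].
Proof.
move=> [h1 l0 h2]; have [M M0 HM] := cvg_norm_bounded h2.
exists (M + l + 1); first by lra.
near=> n; split.
  apply/andP; split.
    by near: n; apply: (cvgr_ge l h1); lra.
  suff : mu n <= l + 1 by lra.
  by near: n; apply: (cvgr_le l h1); lra.
have : `|Num.sqrt n%:R * (mu n - l)| <= M by near: n.
rewrite normrM ger0_norm ?sqrtr_ge0// => H.
have E : n%:R = Num.sqrt n%:R ^+ 2 :> R by rewrite sqr_sqrtr.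
have R0 : 0 <= Num.sqrt n%:R :> R by exact: sqrtr_ge0.
rewrite {1}E; set s := Num.sqrt _ in R0 H *.
by rewrite expr2 -mulrA mulrC ler_wpM2r//; lra.
Unshelve. all: by end_near. Qed.

Lemma server_limit_bounds (R : realType) (srv : nat -> nat) (nu : R) :
  server_limit srv nu -> exists2 M : R, 0 <= M &
  \forall n \near \oo, `|(srv n)%:R - n%:R * nu| <= M * Num.sqrt n%:R.
Proof.
move=> [_ _ h2]; have [M M0 HM] := cvg_norm_bounded h2.
exists M => //; near=> n.
have : `|Num.sqrt n%:R * ((srv n)%:R / n%:R - nu)| <= M by near: n.
have n0 : (0 < n)%N by near: n; exact: nbhs_infty_gt.
have s0 : 0 < Num.sqrt n%:R :> R by rewrite sqrtr_gt0 ltr0n.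
have E : n%:R = Num.sqrt n%:R ^+ 2 :> R by rewrite sqr_sqrtr.
set s := Num.sqrt _ in s0 E *; rewrite E => H.
have -> : (srv n)%:R - s ^+ 2 * nu = s * ((srv n)%:R / s ^+ 2 - nu) * s.
  by field; rewrite gt_eqF.
by rewrite normrM (gtr0_norm s0) ler_wpM2r// ltW.
Unshelve. all: by end_near. Qed.

Lemma arrival_limit_bounds (R : realType) (lam : nat -> R) l hl :
  arrival_limit lam l hl -> exists2 M : R, 0 <= M &
  \forall n \near \oo, lam n <= M * n%:R /\
     `|lam n - n%:R * l| <= M * Num.sqrt n%:R.
Proof.
move=> [_ l0 h2]; have [M M0 HM] := cvg_norm_bounded h2.
exists (M + l); first by lra.
near=> n.
have : `|(lam n - n%:R * l) / Num.sqrt n%:R| <= M by near: n.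
have n0 : (0 < n)%N by near: n; exact: nbhs_infty_gt.
have s0 : 0 < Num.sqrt n%:R :> R by rewrite sqrtr_gt0 ltr0n.
have s1 : 1 <= Num.sqrt n%:R :> R by rewrite -[leLHS]sqrtr1 ler_wsqrtr// ler1n.
have E : n%:R = Num.sqrt n%:R ^+ 2 :> R by rewrite sqr_sqrtr.
rewrite normrM normfV (gtr0_norm s0) ler_pdivrMr//.
set s := Num.sqrt _ in s0 s1 E *; rewrite E => H.
split; last by nra.
have : lam n - s ^+ 2 * l <= M * s by apply: le_trans H; exact: ler_norm.
have : M * s <= M * s ^+ 2 by rewrite ler_wpM2l// expr2 ler_peMl// ltW.
by rewrite mulrDl (mulrC l); lra.
Unshelve. all: by end_near. Qed.

(** Since the two fractions add up to 1, rounding one down and the other up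
    exhausts pool 2, at the cost of at most one server. *)
Lemma pools_split (R : realType) (a : network R) (L : limits R) n :
  0 <= xi12 L -> 0 <= xi22 L -> xi12 L + xi22 L = 1 ->
  (srv12 a L n + srv22 a L n = srv2 a n)%N /\
  `|(srv12 a L n)%:R - xi12 L * (srv2 a n)%:R| <= 1.
Proof.
move=> h1 h2 h12; rewrite /srv12 /srv22.
set N := srv2 a n.
have e2 : xi22 L * N%:R = - (xi12 L * N%:R) + (Posz N)%:~R.
  by rewrite (_ : xi22 L = 1 - xi12 L); [rewrite -pmulrn; ring|lra].
set y := xi12 L * N%:R in e2 *.
have y0 : 0 <= y by rewrite mulr_ge0.
have f0 : 0 <= Num.floor y by rewrite floor_ge0.
have c0 : 0 <= Num.ceil (xi22 L * N%:R).
  by rewrite -(@ceil0 R) le_ceil// mulr_ge0.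
have ce : Num.ceil (xi22 L * N%:R) = Posz N - Num.floor y.
  by rewrite e2 ceilDrz ?intr_int// ceilNfloor opprK intrKceil addrC.
split; first by move: c0; rewrite ce => c0; lia.
rewrite (_ : (`|Num.floor y|%N)%:R = (Num.floor y)%:~R); last first.
  by rewrite -[in RHS](gez0_abs f0) pmulrn.
have := floor_le y; have := floorD1_gt y.
rewrite intrD ler_norml => ? ?; apply/andP; split; lra.
Qed.

Lemma normD2_le (R : realType) (x y a b : R) :
  `|x| <= a -> `|y| <= b -> `|x + y| <= a + b.
Proof. by move=> xa yb; rewrite (le_trans (ler_normD _ _))// lerD. Qed.

Lemma normB2_le (R : realType) (x y a b : R) :
  `|x| <= a -> `|y| <= b -> `|x - y| <= a + b.
Proof. by move=> xa yb; apply: normD2_le; rewrite ?normrN. Qed.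

Lemma normM_le (R : realType) (x y a b : R) :
  `|x| <= a -> `|y| <= b -> `|x * y| <= a * b.
Proof. by move=> xa yb; rewrite normrM ler_pM. Qed.

(** The net input at full staffing is O(sqrt n) because its fluid part vanishes:
    the critical load gives llam1 = lmu11 nu1 + lmu12 xi12 nu2 and
    llam2 = lmu22 xi22 nu2; the rest are products of bounded quantities with
    fluctuations of order sqrt n. *)
Lemma regime_near (R : realType) (a : network R) (L : limits R) :
  halfin_whitt a L -> 0 < lgam1 L -> 0 < lgam2 L ->
  exists c K : R, [/\ 0 < c, c <= K &
    exists n0 : nat, forall n, (n0 <= n)%N -> regime a L c K n].
Proof.
move=> H hg1 hg2.
have [Ml1 Ml10 L1] := arrival_limit_bounds (hw_lam1 H).
have [Ml2 Ml20 L2] := arrival_limit_bounds (hw_lam2 H).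
have [M11 M110 S11] := service_limit_bounds (hw_mu11 H).
have [M12 M120 S12] := service_limit_bounds (hw_mu12 H).
have [M22 M220 S22] := service_limit_bounds (hw_mu22 H).
have [Mn1 Mn10 V1] := server_limit_bounds (hw_srv1 H).
have [Mn2 Mn20 V2] := server_limit_bounds (hw_srv2 H).
have [g1 _] := hw_gam1 H; have [g2 _] := hw_gam2 H.
have [_ l11 _] := hw_mu11 H; have [_ l12 _] := hw_mu12 H.
have [_ l22 _] := hw_mu22 H; have [_ nu10 _] := hw_srv1 H.
have [_ nu20 _] := hw_srv2 H; have [_ la2 _] := hw_lam2 H.
have ov := hw_overload H; have crit := hw_critical H.
have x12 : 0 <= xi12 L.
  by apply: divr_ge0; [rewrite subr_ge0; exact: ltW|apply: mulr_ge0; apply: ltW].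
have x22 : 0 <= xi22 L.
  by apply: divr_ge0; [exact: ltW|apply: mulr_ge0; apply: ltW].
have e12 : lmu12 L * (xi12 L * nu2 L) = llam1 L - lmu11 L * nu1 L.
  by rewrite /xi12; field; rewrite !gt_eqF.
have e22 : lmu22 L * (xi22 L * nu2 L) = llam2 L.
  by rewrite /xi22; field; rewrite !gt_eqF.
set c := Num.min (lgam1 L / 2) (Num.min (lgam2 L / 2) (Num.min (lmu11 L / 2)
  (Num.min (lmu12 L / 2) (lmu22 L / 2)))).
(* E12 and E22 bound the errors of the staffing levels, F1 and F2 those of the
   net inputs, in units of sqrt n. *)
pose E12 := 1 + xi12 L * Mn2; pose E22 := 1 + xi22 L * Mn2 + Mn2 + E12.
have E120 : 0 <= E12 by rewrite /E12; apply: addr_ge0 => //; apply: mulr_ge0.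
have E220 : 0 <= E22 by rewrite /E22; do !apply: addr_ge0 => //; apply: mulr_ge0.
have nu1_0 := ltW nu10; have nu2_0 := ltW nu20.
have xs1 : 0 <= (xstar L).1.
  by rewrite /xstar; apply: addr_ge0 => //; apply: mulr_ge0.
have xs2 : 0 <= (xstar L).2 by rewrite /xstar; apply: mulr_ge0.
pose F1 := Ml1 + M11 * Mn1 + nu1 L * M11 + M12 * E12 + xi12 L * nu2 L * M12.
pose F2 := Ml2 + M22 * E22 + xi22 L * nu2 L * M22.
have F10 : 0 <= F1 by rewrite /F1; do !apply: addr_ge0 => //; do ?apply: mulr_ge0 => //.
have F20 : 0 <= F2 by rewrite /F2; do !apply: addr_ge0 => //; do ?apply: mulr_ge0 => //.
set K := \big[Num.max/0]_(x <- [:: F1; F2; E22; Mn1 + E12; Ml1; Ml2; M11; M12;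
  M22; lgam1 L + 1; lgam2 L + 1; (xstar L).1; (xstar L).2]) x.
have /andP[K1 /andP[K2 /andP[K3 /andP[K4 /andP[K5 /andP[K6 /andP[K7 /andP[K8
  /andP[K9 /andP[K10 /andP[K11 /andP[K12 /andP[K13 _]]]]]]]]]]]]] :
  all (fun x => x <= K) [:: F1; F2; E22; Mn1 + E12; Ml1; Ml2; M11; M12;
  M22; lgam1 L + 1; lgam2 L + 1; (xstar L).1; (xstar L).2].
  by apply/allP => x xs; exact: le_bigmax_seq.
have c0 : 0 < c by rewrite /c !lt_min !divr_gt0.
exists c, K; split => //.
  apply: (@le_trans _ _ (lgam1 L / 2)); first by rewrite /c ge_min lexx.
  by apply: le_trans K10; clear -hg1; lra.
suff [N _ HN] : \forall n \near \oo, regime a L c K n by exists N; exact: HN.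
near=> n.
have n0 : (0 < n)%N by near: n; exact: nbhs_infty_gt.
have nR : 0 <= n%:R :> R by [].
have s0 : 0 < Num.sqrt n%:R :> R by rewrite sqrtr_gt0 ltr0n.
have s1 : 1 <= Num.sqrt n%:R :> R.
  by rewrite -[leLHS]sqrtr1 ler_wsqrtr// ler1n.
have hl1 : lam1 a n <= Ml1 * n%:R /\
  `|lam1 a n - n%:R * llam1 L| <= Ml1 * Num.sqrt n%:R by near: n.
have hl2 : lam2 a n <= Ml2 * n%:R /\
  `|lam2 a n - n%:R * llam2 L| <= Ml2 * Num.sqrt n%:R by near: n.
have h11 : [/\ lmu11 L / 2 <= mu11 a n <= M11 &
  n%:R * `|mu11 a n - lmu11 L| <= M11 * Num.sqrt n%:R] by near: n.
have h12 : [/\ lmu12 L / 2 <= mu12 a n <= M12 &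
  n%:R * `|mu12 a n - lmu12 L| <= M12 * Num.sqrt n%:R] by near: n.
have h22 : [/\ lmu22 L / 2 <= mu22 a n <= M22 &
  n%:R * `|mu22 a n - lmu22 L| <= M22 * Num.sqrt n%:R] by near: n.
have hv1 : `|(srv1 a n)%:R - n%:R * nu1 L| <= Mn1 * Num.sqrt n%:R by near: n.
have hv2 : `|(srv2 a n)%:R - n%:R * nu2 L| <= Mn2 * Num.sqrt n%:R by near: n.
have hg1u : gam1 a n <= lgam1 L + 1.
  by near: n; apply: (cvgr_le (lgam1 L) g1); rewrite ltrDl.
have hg2u : gam2 a n <= lgam2 L + 1.
  by near: n; apply: (cvgr_le (lgam2 L) g2); rewrite ltrDl.
have hg1l : lgam1 L / 2 <= gam1 a n.
  by near: n; apply: (cvgr_ge (lgam1 L) g1); rewrite ltr_pdivrMr// ltr_pMr// ltr1n.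
have hg2l : lgam2 L / 2 <= gam2 a n.
  by near: n; apply: (cvgr_ge (lgam2 L) g2); rewrite ltr_pdivrMr// ltr_pMr// ltr1n.
have [sp rnd] := @pools_split R a L n x12 x22 crit.
have [[lam10 lam20 _ _] _] := hw_rates H n.
have cg1 : c <= lgam1 L / 2 by rewrite /c !ge_min lexx.
have cg2 : c <= lgam2 L / 2 by rewrite /c !ge_min lexx ?orbT.
have c11 : c <= lmu11 L / 2 by rewrite /c !ge_min lexx ?orbT.
have c12 : c <= lmu12 L / 2 by rewrite /c !ge_min lexx ?orbT.
have c22 : c <= lmu22 L / 2 by rewrite /c !ge_min lexx ?orbT.
clearbody c K.
set s := Num.sqrt n%:R in s0 s1 hl1 hl2 h11 h12 h22 hv1 hv2.
move: hl1 hl2 h11 h12 h22 => [hl1 dl1] [hl2 dl2] [/andP[h11 h11'] d11]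
  [/andP[h12 h12'] d12] [/andP[h22 h22'] d22].
have sge0 := ltW s0.
have r12 : `|(srv12 a L n)%:R - n%:R * (xi12 L * nu2 L)| <= E12 * s.
  have -> : (srv12 a L n)%:R - n%:R * (xi12 L * nu2 L) =
    ((srv12 a L n)%:R - xi12 L * (srv2 a n)%:R)
     + xi12 L * ((srv2 a n)%:R - n%:R * nu2 L) by ring.
  rewrite /E12 mulrDl mul1r; apply: normD2_le; first exact: le_trans s1.
  by rewrite -mulrA; apply: normM_le => //; rewrite ger0_norm.
have r22 : `|(srv22 a L n)%:R - n%:R * (xi22 L * nu2 L)| <= E22 * s.
  have -> : (srv22 a L n)%:R - n%:R * (xi22 L * nu2 L) =
    ((srv2 a n)%:R - n%:R * nu2 L)
     - ((srv12 a L n)%:R - n%:R * (xi12 L * nu2 L)).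
    have e1 : xi22 L = 1 - xi12 L by rewrite -crit addrC addKr.
    by rewrite -sp natrD e1; ring.
  apply: (@le_trans _ _ (Mn2 * s + E12 * s)).
    exact: normB2_le.
  rewrite /E22 -mulrDl ler_wpM2r//.
  by rewrite lerD2r lerDr addr_ge0// mulr_ge0.
have mono (M x : R) : 0 <= x -> M <= K -> M * x <= K * x.
  by move=> x0 MK; rewrite ler_wpM2r.
have p11 := le_trans c11 h11.
have m11 : `|mu11 a n| <= M11 by rewrite ger0_norm// (le_trans (ltW c0)).
have p12 := le_trans c12 h12.
have m12 : `|mu12 a n| <= M12 by rewrite ger0_norm// (le_trans (ltW c0)).
have p22 := le_trans c22 h22.
have m22 : `|mu22 a n| <= M22 by rewrite ger0_norm// (le_trans (ltW c0)).
have d11' : `|n%:R * (mu11 a n - lmu11 L)| <= M11 * s.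
  by rewrite normrM ger0_norm.
have d12' : `|n%:R * (mu12 a n - lmu12 L)| <= M12 * s.
  by rewrite normrM ger0_norm.
have d22' : `|n%:R * (mu22 a n - lmu22 L)| <= M22 * s.
  by rewrite normrM ger0_norm.
split => //; rewrite -/s.
- by rewrite lam10/= (le_trans hl1)// mono.
- by rewrite lam20/= (le_trans hl2)// mono.
- by rewrite (le_trans cg1)// (le_trans hg1u).
- by rewrite (le_trans cg2)// (le_trans hg2u).
- by rewrite p11 (le_trans h11').
- by rewrite p12 (le_trans h12').
- by rewrite p22 (le_trans h22').
- by rewrite !ger0_norm.
- apply: (@le_trans _ _ ((Mn1 + E12) * s)); last exact: mono.
  rewrite natrD /= mulrDr opprD addrACA mulrDl.
  exact: normD2_le.
- by apply: (le_trans r22); exact: mono.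
- apply: (@le_trans _ _ (F1 * s)); last exact: mono.
  have -> : lam1 a n - mu11 a n * (srv1 a n)%:R - mu12 a n * (srv12 a L n)%:R =
    (lam1 a n - n%:R * llam1 L) - mu11 a n * ((srv1 a n)%:R - n%:R * nu1 L)
    - nu1 L * (n%:R * (mu11 a n - lmu11 L))
    - mu12 a n * ((srv12 a L n)%:R - n%:R * (xi12 L * nu2 L))
    - xi12 L * nu2 L * (n%:R * (mu12 a n - lmu12 L)).
    have e1 : llam1 L = lmu12 L * (xi12 L * nu2 L) + lmu11 L * nu1 L.
      by rewrite e12 subrK.
    by rewrite e1; ring.
  rewrite /F1 !mulrDl.
  refine (normB2_le (normB2_le (normB2_le (normB2_le _ _) _) _) _) => //.
  + by rewrite -mulrA; apply: normM_le.
  + by rewrite -mulrA; apply: normM_le; rewrite // ger0_norm.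
  + by rewrite -mulrA; apply: normM_le.
  + by rewrite -[leRHS]mulrA; apply: normM_le; rewrite // ger0_norm// mulr_ge0.
- apply: (@le_trans _ _ (F2 * s)); last exact: mono.
  have -> : lam2 a n - mu22 a n * (srv22 a L n)%:R =
    (lam2 a n - n%:R * llam2 L)
    - mu22 a n * ((srv22 a L n)%:R - n%:R * (xi22 L * nu2 L))
    - xi22 L * nu2 L * (n%:R * (mu22 a n - lmu22 L)).
    by rewrite -e22; ring.
  rewrite /F2 !mulrDl; refine (normB2_le (normB2_le _ _) _) => //.
  + by rewrite -mulrA; apply: normM_le.
  + by rewrite -[leRHS]mulrA; apply: normM_le; rewrite // ger0_norm// mulr_ge0.
Unshelve. all: by end_near. Qed.

(** * The Lyapunov drift inequality *)

(** Service and abandonment rates in [c, K] acting on deviations of a common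
    sign push back with slope at least c, up to the shift e between the staffing
    level and the fluid level. *)
Lemma restoring_force (R : realType) (c K y e b1 b2 b3 m1 m2 m3 : R) : 0 < c ->
  c <= m1 <= K -> c <= m2 <= K -> c <= m3 <= K -> `|e| <= K ->
  b1 + b2 + b3 = y + e ->
  [/\ 0 <= b1, 0 <= b2 & 0 <= b3] \/ [/\ b1 <= 0, b2 <= 0 & b3 <= 0] ->
  c * y ^+ 2 - 2 * K ^+ 2 * `|y| <= y * (m1 * b1 + m2 * b2 + m3 * b3).
Proof.
move=> c0 hm1 hm2 hm3.
wlog : y e b1 b2 b3 / [/\ 0 <= b1, 0 <= b2 & 0 <= b3].
  move=> H he hb [hs|[h1 h2 h3]]; first by apply: (H y e) => //; left.
  have := H (- y) (- e) (- b1) (- b2) (- b3); rewrite !normrN !oppr_ge0 h1 h2 h3.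
  rewrite !mulrN -!opprD mulrNN sqrrN hb; apply => //; first by left.
move=> [p1 p2 p3] he hb _.
set D := (m1 - c) * b1 + (m2 - c) * b2 + (m3 - c) * b3.
move: hm1 hm2 hm3 => /andP[c1 k1] /andP[c2 k2] /andP[c3 k3].
have D0 : 0 <= D by rewrite /D !addr_ge0// mulr_ge0// subr_ge0.
have DK : D <= K * (y + e).
  rewrite -hb /D !mulrDr; apply: lerD; [apply: lerD|].
  - by apply: ler_wpM2r => //; clear -c0 k1; lra.
  - by apply: ler_wpM2r => //; clear -c0 k2; lra.
  - by apply: ler_wpM2r => //; clear -c0 k3; lra.
have -> : y * (m1 * b1 + m2 * b2 + m3 * b3) = c * y ^+ 2 + c * (y * e) + y * D.
  rewrite (_ : m1 * b1 + m2 * b2 + m3 * b3 = c * (b1 + b2 + b3) + D).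
    by rewrite hb; ring.
  by rewrite /D; ring.
clearbody D.
have K0 : 0 <= K by rewrite (le_trans (normr_ge0 e)).
have cK : c <= K by rewrite (le_trans c1).
have ye : - (K * `|y|) <= y * e.
  by rewrite lerNl (le_trans (ler_norm _))// normrN normrM mulrC ler_wpM2r.
have cye : - (K ^+ 2 * `|y|) <= c * (y * e).
  have h : c * - (K * `|y|) <= c * (y * e) by rewrite ler_wpM2l// ltW.
  apply: le_trans h; rewrite mulrN lerN2 expr2 -mulrA ler_wpM2r// mulr_ge0//.
suff yD : - (K ^+ 2 * `|y|) <= y * D by clear -cye yD; lra.
have [y0|y0] := leP 0 y.
  apply: (@le_trans _ _ 0); last exact: mulr_ge0.
  by rewrite oppr_le0 mulr_ge0// sqr_ge0.
have DK2 : D <= K ^+ 2.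
  apply: (le_trans DK); rewrite expr2 ler_wpM2l//.
  by move: (ler_norm e) => he'; clear -y0 he he'; lra.
by rewrite ltr0_norm// mulrN opprK mulrC ler_wnM2l// ltW.
Qed.

(** One class seen as a birth-death chain. The three service streams are the two
    pools and the abandonments; a class that uses a single pool fits with an
    empty second stream. *)
Lemma class_drift (R : realType) (k c K : R) : 2 <= k -> 0 < c -> c <= K ->
  exists2 C1 : R, 0 < C1 &
  forall (n x a1 a2 a3 N1 N2 : nat) (m1 m2 m3 lam X : R), (0 < n)%N ->
  (a1 + a2 + a3 = x)%N ->
  [/\ a1 <= N1, a2 <= N2 & a3 = 0]%N \/ (N1 <= a1 /\ N2 <= a2)%N ->
  c <= m1 <= K -> c <= m2 <= K -> c <= m3 <= K -> 0 <= lam <= K * n%:R ->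
  `|X| <= K -> `|(N1 + N2)%:R - n%:R * X| <= K * Num.sqrt n%:R ->
  `|lam - m1 * N1%:R - m2 * N2%:R| <= K * Num.sqrt n%:R ->
  forall y : nat -> R, (forall t, y t = (t%:R - n%:R * X) / Num.sqrt n%:R) ->
  lam * (`|y x.+1| `^ k - `|y x| `^ k) +
  (m1 * a1%:R + m2 * a2%:R + m3 * a3%:R) * (`|y x.-1| `^ k - `|y x| `^ k)
    <= C1 - c * `|y x| `^ k.
Proof.
move=> k2 c0 cK; have K0 : 0 <= K by rewrite (le_trans (ltW c0)).
(* K' has to dominate K + 2 K^2 in the drift and K + K^2 in the variance. *)
set K' := 2 * K + 2 * K ^+ 2.
have K'0 : 0 <= K' by rewrite addr_ge0// mulr_ge0// sqr_ge0.
have [C1 C10 HC] := birth_death_drift k2 K'0 c0.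
exists C1 => // n x a1 a2 a3 N1 N2 m1 m2 m3 lam X n0 ax hs hm1 hm2 hm3.
move=> /andP[lam0 lamK] XK stf net y yE.
have s0 : 0 < Num.sqrt n%:R :> R by rewrite sqrtr_gt0 ltr0n.
have s1 : 1 <= Num.sqrt n%:R :> R by rewrite -[leLHS]sqrtr1 ler_wsqrtr// ler1n.
have E : n%:R = Num.sqrt n%:R ^+ 2 :> R by rewrite sqr_sqrtr.
rewrite !yE; set r := Num.sqrt n%:R in s0 s1 E stf net *.
have rn : r != 0 by rewrite gt_eqF.
set rm := m1 * a1%:R + m2 * a2%:R + m3 * a3%:R.
have m1c : 0 <= m1 by case/andP: hm1 => h _; exact: le_trans (ltW c0) h.
have m2c : 0 <= m2 by case/andP: hm2 => h _; exact: le_trans (ltW c0) h.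
have m3c : 0 <= m3 by case/andP: hm3 => h _; exact: le_trans (ltW c0) h.
have rm0 : 0 <= rm by rewrite /rm !addr_ge0// mulr_ge0.
set Y := (x%:R - n%:R * X) / r.
have -> : (x.+1%:R - n%:R * X) / r = Y + r^-1.
  by rewrite /Y -natr1; field.
have -> : rm * (`|(x.-1%:R - n%:R * X) / r| `^ k - `|Y| `^ k)
    = rm * (`|Y - r^-1| `^ k - `|Y| `^ k).
  (* In an empty class all the death rates vanish, so that the truncation
     0.-1 = 0 does no harm. *)
  case: x ax @Y => [|x] ax Y /=; last first.
    congr (_ * (`|_| `^ _ - _)); rewrite /Y -natr1; field; exact: rn.
  rewrite /rm; have [-> -> ->] : [/\ a1 = 0, a2 = 0 & a3 = 0]%N.
    by move/eqP: ax; rewrite !addn_eq0 => /andP[/andP[/eqP-> /eqP->] /eqP->].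
  by rewrite !mulr0 !addr0 !mul0r.
have ri0 : 0 <= r^-1 by rewrite invr_ge0 ltW.
have ri1 : r^-1 <= 1 by rewrite invf_le1.
apply: HC => //; first by rewrite ri0.
  set e := (n%:R * X - (N1 + N2)%:R) / r.
  have he : `|e| <= K.
    by rewrite normrM normfV (gtr0_norm s0) ler_pdivrMr// distrC.
  set l := (lam - m1 * N1%:R - m2 * N2%:R) / r.
  have hl : `|l| <= K.
    by rewrite normrM normfV (gtr0_norm s0) ler_pdivrMr.
  set b1 := (a1%:R - N1%:R) / r; set b2 := (a2%:R - N2%:R) / r.
  set b3 := a3%:R / r.
  have hb : b1 + b2 + b3 = Y + e.
    by rewrite /b1 /b2 /b3 /Y /e -ax !natrD; field.
  have hsb : [/\ 0 <= b1, 0 <= b2 & 0 <= b3] \/ [/\ b1 <= 0, b2 <= 0 & b3 <= 0].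
    case: hs => [[h1 h2 h3]|[h1 h2]]; [right|left]; split.
    - by rewrite /b1 mulr_le0_ge0// subr_le0 ler_nat.
    - by rewrite /b2 mulr_le0_ge0// subr_le0 ler_nat.
    - by rewrite /b3 h3 mul0r.
    - by rewrite /b1 mulr_ge0// subr_ge0 ler_nat.
    - by rewrite /b2 mulr_ge0// subr_ge0 ler_nat.
    - by rewrite /b3 mulr_ge0.
  have H := restoring_force c0 hm1 hm2 hm3 he hb hsb.
  have -> : (lam - rm) * r^-1 = l - (m1 * b1 + m2 * b2 + m3 * b3).
    by rewrite /l /b1 /b2 /b3 /rm; field.
  rewrite mulrBr.
  have Yl : Y * l <= K * `|Y|.
    by rewrite (le_trans (ler_norm _))// normrM mulrC ler_wpM2r.
  have Ky : 0 <= K * `|Y| by rewrite mulr_ge0.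
  rewrite /K'; clear -Yl Ky H; lra.
have -> : r^-1 ^+ 2 = n%:R^-1 by rewrite E exprVn.
have nR : 0 < n%:R :> R by rewrite ltr0n.
rewrite mulrDl.
have H1 : lam / n%:R <= K by rewrite ler_pdivrMr.
have H2 : rm / n%:R <= K * (K + `|Y|).
  apply: (@le_trans _ _ (K * (x%:R / n%:R))).
    rewrite mulrA ler_wpM2r ?invr_ge0// /rm -ax !natrD !mulrDr.
    case/andP: hm1 => _ h1; case/andP: hm2 => _ h2; case/andP: hm3 => _ h3.
    by apply: lerD; [apply: lerD|]; apply: ler_wpM2r.
  rewrite ler_wpM2l//.
  have -> : x%:R / n%:R = X + Y / r.
    by rewrite /Y E; field.
  rewrite lerD ?(le_trans (ler_norm _) XK)//.
  by rewrite (le_trans (ler_norm _))// normrM normfV (gtr0_norm s0) ler_piMr.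
apply: (le_trans (lerD H1 H2)); rewrite /K'.
have Ky : 0 <= K * `|Y| by rewrite mulr_ge0.
have Kyy : 0 <= K ^+ 2 * `|Y| by rewrite mulr_ge0// sqr_ge0.
have KK : 0 <= K ^+ 2 by rewrite sqr_ge0.
clear -Ky Kyy KK K0; lra.
Qed.

(** The Lyapunov function separates the classes and so does the drift: each
    class relaxes towards its own staffing level, which is why the weight beta
    can be arbitrary. *)
Lemma lyapunov_drift (R : realType) (k c K beta : R) :
  2 <= k -> 0 < c -> c <= K -> 0 < beta ->
  exists2 C1 : R, 0 < C1 &
  forall (a : network R) (L : limits R) n, regime a L c K n -> forall x,
  genhat a L n (lyap k beta) x <= C1 - c * lyap k beta (xhat L n x).
Proof.
move=> k2 c0 cK b0; have [C1 C10 HC] := class_drift k2 c0 cK.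
exists ((1 + beta) * C1); first by rewrite mulr_gt0// addr_gt0.
move=> a L n [n0 sp l1 l2 g1 g2 m11 m12 m22 [X1 X2] t1 t2 e1 e2] x.
have [s1 d1] := class1_split x sp; have [s2 d2] := class2_split x sp.
have H1 := HC n x.1 _ _ _ _ _ _ _ _ _ _ n0 s1 d1 m11 m12 g1 l1 X1 t1 e1 _
  (fun=> erefl).
pose y (t : nat) := (t%:R - n%:R * (xstar L).2) / Num.sqrt n%:R.
have H2 : lam2 a n * (`|y x.2.+1| `^ k - `|y x.2| `^ k) +
    (mu22 a n * (z22 a L n x)%:R + mu22 a n * 0 + gam2 a n * (q2 a L n x)%:R)
      * (`|y x.2.-1| `^ k - `|y x.2| `^ k) <= C1 - c * `|y x.2| `^ k.
  apply: (HC n x.2 (z22 a L n x) 0%N (q2 a L n x) (srv22 a L n) 0%N) => //.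
  - by rewrite addn0.
  - by case: d2 => [[? ?]|?]; [left|right].
  - exact: X2.
  - by rewrite addn0.
  - by rewrite mulr0 subr0.
move: H1 H2; rewrite /y /genhat /gen /lyap /xhat /=.
set A := _ `^ k; set B := _ `^ k; set B' := _ `^ k.
set A2 := _ `^ k; set B2 := _ `^ k; set B2' := _ `^ k => H1 H2.
have {}H2 := ler_wpM2l (ltW b0) H2.
by apply: (etrans _ (lerD H1 H2)); congr (_ <= _); ring.
Qed.

(** * Means of bounded functions *)

Lemma measurable_state (B : set state) : measurable B.
Proof.
apply: countable_measurable; last exact: countableP.
move=> z; rewrite (_ : [set z] = [set z.1] `*` [set z.2]); first exact: measurableX.
by apply/seteqP; split => [w ->//|[a b] [/= -> ->]]; case: z.
Qed.

Lemma measurable_fun_state d (U : measurableType d) (f : state -> U) :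
  measurable_fun setT f.
Proof. by move=> _ Y _; exact: measurable_state. Qed.

Definition bnd (T : Type) (R : realType) (f : T -> R) : Prop :=
  exists M : R, forall x, `|f x| <= M.

Lemma bnd_lin (T : Type) (R : realType) (f g : T -> R) (c : R) :
  bnd f -> bnd g -> bnd (fun x => f x + c * g x).
Proof.
move=> [M fM] [N gN]; exists (M + `|c| * N) => x.
by rewrite (le_trans (ler_normD _ _))// lerD// normrM ler_wpM2l.
Qed.

Lemma bnd_cst (T : Type) (R : realType) (c : R) : bnd (fun _ : T => c).
Proof. by exists `|c|. Qed.

Lemma bnd_indic (T : Type) (R : realType) (B : set T) : bnd (\1_B : T -> R).
Proof. by exists 1 => x; rewrite indicE; case: (_ \in _); rewrite ?normr1 ?normr0. Qed.

(** Integration against a probability, iterated integration and limits of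
    integrals are all instances of this notion, so that they can be compared
    through their values on indicators alone. *)
Record mean_functional (T : Type) (R : realType) (Lam : (T -> R) -> R) : Prop :=
  MeanFunctional {
  mf_lin : forall f g c, bnd f -> bnd g ->
    Lam (fun x => f x + c * g x) = Lam f + c * Lam g;
  mf_le : forall f g, bnd f -> bnd g -> (forall x, f x <= g x) -> Lam f <= Lam g;
  mf_cst : forall c, Lam (fun=> c) = c }.

Section mean_functional_theory.
Context (T : Type) (R : realType) (Lam : (T -> R) -> R).
Hypothesis HL : mean_functional Lam.

Lemma mf_bounds (f : T -> R) (a b : R) : (forall x, a <= f x <= b) -> a <= Lam f <= b.
Proof.
move=> fab; have bf : bnd f.
  exists (Num.max `|a| `|b|) => x; have /andP[h1 h2] := fab x.
  rewrite ler_norml; apply/andP; split.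
    rewrite lerNl le_max; apply/orP; left.
    by apply: (@le_trans _ _ (- a)); [rewrite lerN2|rewrite -normrN ler_norm].
  by rewrite le_max (le_trans h2 (ler_norm _)) orbT.
have ha := mf_le HL (bnd_cst T a) bf (fun x => proj1 (andP (fab x))).
have hb := mf_le HL bf (bnd_cst T b) (fun x => proj2 (andP (fab x))).
by rewrite !(mf_cst HL) in ha hb; rewrite ha.
Qed.

Lemma mf_norm (f : T -> R) (M : R) : (forall x, `|f x| <= M) -> `|Lam f| <= M.
Proof. by move=> fM; rewrite ler_norml; apply: mf_bounds => x; rewrite -ler_norml. Qed.

Lemma mf_add_cst (f : T -> R) (c : R) : bnd f -> Lam (fun x => f x + c) = Lam f + c.
Proof.
move=> bf; have := mf_lin HL c bf (bnd_cst T (1 : R)).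
by rewrite (mf_cst HL) mulr1 => <-; congr Lam; apply/funext => x; rewrite mulr1.
Qed.

Lemma mf_scale (f : T -> R) (c : R) : bnd f -> Lam (fun x => c * f x) = c * Lam f.
Proof.
move=> bf; have := mf_lin HL c (bnd_cst T (0 : R)) bf.
by rewrite (mf_cst HL) add0r => <-; congr Lam; apply/funext => x; rewrite add0r.
Qed.

Lemma mf_sum (F : nat -> T -> R) N : (forall i, bnd (F i)) ->
  bnd (fun x => \sum_(i < N) F i x) /\
  Lam (fun x => \sum_(i < N) F i x) = \sum_(i < N) Lam (F i).
Proof.
move=> bF; elim: N => [|N [IH1 IH2]].
  under eq_fun do rewrite big_ord0.
  by rewrite big_ord0 (mf_cst HL); split => //; exact: bnd_cst.
under eq_fun do rewrite big_ord_recr /= -[F N _]mul1r.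
by rewrite (mf_lin HL)// big_ord_recr /= IH2 mul1r; split => //; exact: bnd_lin.
Qed.

End mean_functional_theory.

Lemma count_steps (R : realType) (y : R) N : 0 <= y -> y <= N%:R ->
  y - 1 <= \sum_(i < N) (((i.+1)%:R <= y)%R)%:R <= y.
Proof.
move=> y0 yN.
suff : Num.min y N.+1%:R - 1 <= \sum_(i < N) ((i.+1%:R <= y)%R)%:R <= y
    /\ \sum_(i < N) ((i.+1%:R <= y)%R)%:R <= N%:R :> R.
  by move=> [+ _]; rewrite min_l// (le_trans yN)// ler_nat.
elim: N {yN} => [|N [/andP[IH1 IH2] IH3]].
  by rewrite big_ord0 lerBlDr add0r ge_min lexx orbT y0.
rewrite big_ord_recr /=; set S := \sum_(_ < _) _ in IH1 IH2 IH3 *.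
have NS : N.+1%:R = N%:R + 1 :> R by rewrite natr1.
have [h|h] := leP N.+1%:R y; last first.
  have my : Num.min y N.+2%:R <= y by rewrite ge_min lexx.
  rewrite (min_l (ltW h)) in IH1; rewrite NS /= addr0 in h *.
  by split; [apply/andP; split|]; lra.
have mN : Num.min y N.+2%:R <= N.+2%:R by rewrite ge_min lexx orbT.
move: mN; rewrite -[N.+2%:R]natr1 NS => mN.
move: IH1; rewrite (min_r h) NS => IH1; rewrite NS in h.
by rewrite /=; split; [apply/andP; split|]; lra.
Qed.

(** Layer-cake approximation: a function with values in [0, 1] is within 1/N of
    an average of N indicators, so a comparison on indicators passes to it. *)
Lemma mf_indic_le (T : Type) (R : realType) (L1 L2 : (T -> R) -> R) (del : R) :
  mean_functional L1 -> mean_functional L2 ->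
  (forall B : set T, L1 \1_B <= L2 \1_B + del) ->
  forall f : T -> R, (forall x, 0 <= f x <= 1) -> L1 f <= L2 f + del.
Proof.
move=> H1 H2 HB f f01.
have bf : bnd f.
  by exists 1 => x; have /andP[h1 h2] := f01 x; rewrite ger0_norm.
suff key N : L1 f - L2 f - del <= N.+1%:R^-1.
  rewrite leNgt; apply/negP; rewrite -subr_gt0 => h.
  have := @ltr_add_invr R 0 _ h => -[N]; rewrite add0r.
  rewrite opprD addrA => /lt_le_trans /(_ (key N)).
  by rewrite ltxx.
have N0 : 0 < N.+1%:R :> R by [].
pose F i : T -> R := \1_[set x | i.+1%:R <= N.+1%:R * f x].
have FE x : \sum_(i < N.+1) F i x
    = \sum_(i < N.+1) ((i.+1%:R <= N.+1%:R * f x)%R)%:R.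
  by apply: eq_bigr => i _; rewrite /F indicE; congr ((nat_of_bool _)%:R); apply/idP/idP;
    rewrite inE.
have FB x : N.+1%:R * f x - 1 <= \sum_(i < N.+1) F i x <= N.+1%:R * f x.
  have /andP[h1 h2] := f01 x.
  rewrite FE; apply: count_steps; first exact: mulr_ge0.
  by rewrite ler_piMr.
have bF i : bnd (F i) by exact: bnd_indic.
have [bS S1] := mf_sum H1 N.+1 bF; have [_ S2] := mf_sum H2 N.+1 bF.
have le1 : N.+1%:R * L1 f - 1 <= \sum_(i < N.+1) L1 (F i).
  rewrite -S1 -(mf_scale H1)//.
  rewrite -(mf_add_cst H1); last first.
    by have := bnd_lin N.+1%:R (bnd_cst T (0:R)) bf; under eq_fun do rewrite add0r.
  apply: (mf_le H1) => //; last by move=> x; case/andP: (FB x).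
  have := bnd_lin N.+1%:R (bnd_cst T (-1:R)) bf.
  by under eq_fun do rewrite addrC.
have le2 : \sum_(i < N.+1) L2 (F i) <= N.+1%:R * L2 f.
  rewrite -S2 -(mf_scale H2)//.
  apply: (mf_le H2) => //; last by move=> x; case/andP: (FB x).
  by have := bnd_lin N.+1%:R (bnd_cst T (0:R)) bf; under eq_fun do rewrite add0r.
have le3 : \sum_(i < N.+1) L1 (F i) <= \sum_(i < N.+1) L2 (F i) + N.+1%:R * del.
  have -> : N.+1%:R * del = \sum_(i < N.+1) del.
    by rewrite sumr_const card_ord mulr_natl.
  by rewrite -big_split /=; apply: ler_sum => i _; exact: HB.
rewrite -(ler_pM2l N0) divff ?gt_eqF// !mulrBr; lra.
Qed.

Lemma mf_indic_eq (T : Type) (R : realType) (L1 L2 : (T -> R) -> R) :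
  mean_functional L1 -> mean_functional L2 ->
  (forall B : set T, L1 \1_B = L2 \1_B) -> forall f, bnd f -> L1 f = L2 f.
Proof.
move=> H1 H2 HB.
have key (La Lb : (T -> R) -> R) : mean_functional La -> mean_functional Lb ->
    (forall B : set T, La \1_B = Lb \1_B) -> forall f, bnd f -> La f <= Lb f.
  move=> Ha Hb Hab f bf; have [M fM] := bf.
  (* 1/2 + c f takes its values in [0, 1]. *)
  set c := (2 * (`|M| + 1))^-1.
  have c0 : 0 < c by rewrite invr_gt0 mulr_gt0// ltr_wpDl.
  have E (Lx : (T -> R) -> R) : mean_functional Lx ->
      Lx (fun x => 2^-1 + c * f x) = 2^-1 + c * Lx f.
    by move=> Hx; rewrite (mf_lin Hx)// ?(mf_cst Hx)//; exact: bnd_cst.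
  have : La (fun x => 2^-1 + c * f x) <= Lb (fun x => 2^-1 + c * f x) + 0.
    apply: (mf_indic_le Ha Hb); first by move=> B; rewrite addr0 Hab.
    move=> x; have : `|c * f x| <= 2^-1.
      rewrite normrM gtr0_norm// /c invfM -mulrA ler_piMr// mulrC ler_pdivrMr.
        rewrite mul1r (le_trans (fM x))// (le_trans (ler_norm _))//; lra.
      by rewrite ltr_wpDl.
    by rewrite ler_norml => /andP[h1 h2]; apply/andP; split; lra.
  by rewrite addr0 !E// lerD2l ler_pM2l.
move=> f bf; apply/eqP; rewrite eq_le; apply/andP; split; first exact: key.
by apply: key => // B; rewrite HB.
Qed.

Section mean_measure.
Context d (T : measurableType d) (R : realType).
Variable mu : {measure set T -> \bar R}.
Hypothesis mu1 : mu setT = 1%E.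

Lemma integrable_bnd (f : T -> R) : measurable_fun setT f -> bnd f ->
  mu.-integrable setT (EFin \o f).
Proof.
move=> mf [M fM]; apply/integrableP; split; first exact/measurable_EFinP.
apply: (@le_lt_trans _ _ (\int[mu]_x (cst M%:E x))%E).
  apply: ge0_le_integral => //=.
  - by apply/measurable_EFinP; apply: measurableT_comp.
  - by move=> x _; rewrite lee_fin (le_trans _ (fM x)).
by rewrite integral_cst// mu1 mule1 ltry.
Qed.

Lemma Rintegral_indic (B : set T) : measurable B ->
  (\int[mu]_x \1_B x)%R = fine (mu B).
Proof. by move=> mB; rewrite /Rintegral integral_indic// setIT. Qed.

End mean_measure.

Lemma mean_measure_state (R : realType) (mu : {measure set state -> \bar R}) :
  mu setT = 1%E -> mean_functional (fun f => (\int[mu]_x f x)%R).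
Proof.
move=> mu1; have I f : bnd f -> mu.-integrable setT (EFin \o f).
  by move=> bf; apply: integrable_bnd => //; exact: measurable_fun_state.
split.
- move=> f g c bf bg; have If := I _ bf; have Ig := I _ bg.
  have Icg : mu.-integrable setT (EFin \o (fun x => c * g x)).
    apply: I; have := bnd_lin c (bnd_cst _ (0 : R)) bg.
    by under eq_fun do rewrite add0r.
  by rewrite RintegralD// RintegralZl.
- by move=> f g bf bg fg; apply: le_Rintegral => //; exact: I.
- by move=> c; rewrite Rintegral_cst// mu1 mulr1.
Qed.

Lemma mean_comp (T : Type) (R : realType) (Lam : (T -> R) -> R)
    (K : T -> (T -> R) -> R) :
  mean_functional Lam -> (forall x, mean_functional (K x)) ->
  mean_functional (fun f => Lam (fun x => K x f)).
Proof.
move=> HL HK.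
have bK f : bnd f -> bnd (fun x => K x f).
  by move=> [M fM]; exists M => x; exact: (mf_norm (HK x)).
split.
- move=> f g c bf bg; rewrite -(mf_lin HL)//; [|exact: bK|exact: bK].
  by congr Lam; apply/funext => x; rewrite (mf_lin (HK x)).
- move=> f g bf bg fg; apply: (mf_le HL); [exact: bK|exact: bK|].
  by move=> x; exact: (mf_le (HK x)).
- move=> c; rewrite -[RHS](mf_cst HL); congr Lam; apply/funext => x.
  exact: (mf_cst (HK x)).
Qed.

Lemma mean_eval (T : Type) (R : realType) (x : T) :
  mean_functional (fun f : T -> R => f x).
Proof. by split. Qed.

(** * Transition semigroups on bounded functions *)

(** Continuous induction on [0, +oo): a property that holds at 0, passes to
    left limits and propagates a little to the right holds everywhere. *)
Lemma real_induction (R : realType) (G : R -> Prop) :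
  G 0 ->
  (forall t : R, 0 < t -> (forall s, 0 <= s < t -> G s) -> G t) ->
  (forall t : R, 0 <= t -> G t -> \forall h \near 0^'+, G (t + h)) ->
  forall t : R, 0 <= t -> G t.
Proof.
move=> G0 Gl Gr T T0; apply: contrapT => nGT.
pose S := [set t | 0 <= t /\ forall s, 0 <= s <= t -> G s].
have S0 : S 0 by split => // s /andP[s0 s1]; rewrite (_ : s = 0)//; apply/eqP; rewrite eq_le s1.
have ST t : S t -> t <= T.
  by move=> [t0 H]; rewrite leNgt; apply/negP => tT; apply: nGT; apply: H; rewrite T0 ltW.
have hS : has_sup S.
  by apply: conj; [exists 0|exists T; exact: ST].
set sg := sup S.
have sg0 : 0 <= sg by apply: ub_le_sup => //; case: hS.
have Glt s : 0 <= s < sg -> G s.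
  move=> /andP[s0 ssg]; have es : 0 < sg - s by rewrite subr_gt0.
  have [t St] := sup_adherent es hS.
  by rewrite subKr => st; have [_] := St; apply; rewrite s0 ltW.
have Gsg : G sg.
  have [<-//|sgp] : 0 = sg \/ 0 < sg.
    by move: sg0; rewrite le_eqVlt => /orP[/eqP|]; [left|right].
  exact: Gl.
have [e /= e0 He] := Gr sg sg0 Gsg.
have : S (sg + e / 2).
  split; first by rewrite addr_ge0// ltW// divr_gt0.
  move=> s /andP[s0 ss]; have [ssg|ssg|->//] := ltgtP s sg.
    by apply: Glt; rewrite s0.
  rewrite (_ : s = sg + (s - sg)); last by rewrite addrC subrK.
  apply: He; rewrite /= ?subr_gt0//.
  rewrite sub0r normrN gtr0_norm ?subr_gt0// ltrBlDl (le_lt_trans ss)//.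
  by rewrite ltrD2l ltr_pdivrMr// ltr_pMr// ltr1n.
move=> /(ub_le_sup (proj2 hS)); rewrite -/sg; apply/negP; rewrite -ltNge.
by rewrite ltrDl divr_gt0.
Qed.

(** The function g differs from g x by at most 2 M, and only off x. With L = p_h
    this makes t |-> p_t f x continuous from the left, uniformly over
    the functions f bounded by M. *)
Lemma mf_oscillation (T : Type) (R : realType) (Lam : (T -> R) -> R)
    (g : T -> R) (M : R) (x : T) :
  mean_functional Lam -> (forall y, `|g y| <= M) ->
  `|Lam g - g x| <= 2 * M * (1 - Lam \1_[set x]).
Proof.
move=> HL gM; have bg : bnd g by exists M.
have b1 : bnd (\1_[set x] : T -> R) by exact: bnd_indic.
have M0 : 0 <= M by rewrite (le_trans _ (gM x)).
have E c d : Lam (fun y => c + d * \1_[set x] y) = c + d * Lam \1_[set x].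
  by rewrite (mf_lin HL)// ?(mf_cst HL)//; exact: bnd_cst.
have hy y : 2 * M + - (2 * M) * \1_[set x] y = if y == x :> {classic T} then 0 else 2 * M.
  rewrite indicE; case: eqP => [->|ne]; first by rewrite mem_set//= mulr1 subrr.
  by rewrite memNset//= mulr0 addr0.
have bb c d : bnd (fun y : T => c + d * \1_[set x] y :> R).
  by apply: bnd_lin => //; exact: bnd_cst.
rewrite mulrBr mulr1 -mulNr ler_norml; apply/andP; split.
  have : Lam (fun y => (g x - 2 * M) + (2 * M) * \1_[set x] y) <= Lam g.
    apply: (mf_le HL) => // y; have := hy y.
    case: eqP => [->|_]; first by lra.
    by have := gM x; have := gM y; rewrite !ler_norml => /andP[? ?] /andP[? ?]; lra.
  by rewrite E; lra.
have : Lam g <= Lam (fun y => (g x + 2 * M) + (- (2 * M)) * \1_[set x] y).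
  apply: (mf_le HL) => // y; have := hy y.
  case: eqP => [->|_]; first by lra.
  by have := gM x; have := gM y; rewrite !ler_norml => /andP[? ?] /andP[? ?]; lra.
by rewrite E; lra.
Qed.

Lemma near_cvg (T : Type) (U : topologicalType) (F : set_system T)
    {FF : Filter F} (f g : T -> U) (l : U) :
  f @ F --> l -> (\forall x \near F, f x = g x) -> g @ F --> l.
Proof. by move=> fl fg P lP; apply: filterS2 fg (fl P lP) => x /= <-. Qed.

Section semigroup.
Context (R : realType) (A : (state -> R) -> state -> R).
Variable p : R -> R.-pker state ~> state.
Hypothesis hp : transition_semigroup A p.

Definition Et (t : R) (f : state -> R) (x : state) : R := (\int[p t x]_y f y)%R.

Lemma Et_mean t x : mean_functional (fun f => Et t f x).
Proof. by apply: mean_measure_state; exact: prob_kernel. Qed.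

Lemma Et_indic t (B : set state) x : Et t \1_B x = fine (p t x B).
Proof. by rewrite /Et Rintegral_indic//; exact: measurable_state. Qed.

Lemma p_fin t x (B : set state) : p t x B = (Et t \1_B x)%:E.
Proof.
rewrite Et_indic fineK// ge0_fin_numE// (le_lt_trans (le_measure _ _ _ (subsetT B)))//.
- by rewrite inE; exact: measurable_state.
- by rewrite inE.
- by rewrite [ltLHS](_ : _ = 1%E) ?ltry//; exact: prob_kernel.
Qed.

Lemma Et_norm t f M : (forall x, `|f x| <= M) -> forall x, `|Et t f x| <= M.
Proof. by move=> fM x; exact: (mf_norm (Et_mean t x)). Qed.

Lemma Et_bnd t f : bnd f -> bnd (Et t f).
Proof. by move=> [M fM]; exists M; exact: Et_norm. Qed.

Lemma Et0 f x : bnd f -> Et 0 f x = f x.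
Proof.
apply: (mf_indic_eq (Et_mean 0 x) (mean_eval R x)) => B.
by rewrite Et_indic (ts_initial hp)//; exact: measurable_state.
Qed.

Lemma EtD s t f x : 0 <= s -> 0 <= t -> bnd f -> Et (s + t) f x = Et s (Et t f) x.
Proof.
move=> s0 t0; apply: (mf_indic_eq (Et_mean (s + t) x)
  (mean_comp (Et_mean s x) (Et_mean t))) => B.
rewrite Et_indic (ts_chapman_kolmogorov hp)//; last exact: measurable_state.
by rewrite /Et /Rintegral; congr fine; apply: eq_integral => y _; rewrite p_fin.
Qed.

Lemma Et_cvg0 f x : bnd f -> Et h f x @[h --> 0^'+] --> f x.
Proof.
move=> bf; have H := @ts_generator _ _ _ hp f bf x.
have Hh : (h : R) @[h --> 0^'+] --> (0 : R).
  by apply: cvg_within_filter; exact: cvg_id.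
have H' : h * (h^-1 * (Et h f x - f x)) + f x @[h --> 0^'+] --> 0 * A f x + f x.
  by apply: cvgD; [exact: cvgM|exact: cvg_cst].
rewrite mul0r add0r in H'; apply: (near_cvg H').
near=> h.
have h0 : 0 < h by near: h; exact: nbhs_right_gt.
by rewrite /= mulrA divff ?mul1r ?subrK// gt_eqF.
Unshelve. all: by end_near. Qed.

(** The backward equation is immediate for bounded f, as p_t f is again bounded:
    p_(t+h) f - p_t f = p_h (p_t f) - p_t f. *)
Lemma Et_backward t f x : 0 <= t -> bnd f ->
  (h^-1 * (Et (t + h) f x - Et t f x)) @[h --> 0^'+] --> A (Et t f) x.
Proof.
move=> t0 bf; have := @ts_generator _ _ _ hp _ (Et_bnd t bf) x.
move=> H'; apply: (near_cvg H'); near=> h => /=.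
have h0 : 0 < h by near: h; exact: nbhs_right_gt.
by rewrite (addrC t h) (EtD _ (ltW h0)).
Unshelve. all: by end_near. Qed.

Lemma Et_left_cvg t f x : 0 < t -> bnd f ->
  Et (t - h) f x @[h --> 0^'+] --> Et t f x.
Proof.
move=> t0 bf; have [M fM] := bf.
have H : Et h \1_[set x] x @[h --> 0^'+] --> (1 : R).
  rewrite (_ : 1 = \1_[set x] x); last by rewrite indicE mem_set.
  by apply: Et_cvg0; exact: bnd_indic.
have {}H : 2 * M * (1 - Et h \1_[set x] x) @[h --> 0^'+] --> (0 : R).
  rewrite [X in _ --> X](_ : 0 = 2 * M * (1 - 1))//.
    by apply: cvgM; [exact: cvg_cst|apply: cvgB; [exact: cvg_cst|exact: H]].
  by rewrite subrr mulr0.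
apply/cvgrPdist_le => e e0; near=> h.
have h0 : 0 < h by near: h; exact: nbhs_right_gt.
have ht : h < t by near: h; exact: nbhs_right_lt.
have th : 0 <= t - h by rewrite subr_ge0 ltW.
have -> : Et t f x = Et h (Et (t - h) f) x.
  by rewrite -(EtD _ (ltW h0) th bf) addrC subrK.
apply: (le_trans (mf_oscillation x (Et_mean h x) (Et_norm (t - h) fM))).
by near: h; apply: (cvgr_le 0 H).
Unshelve. all: by end_near. Qed.
End semigroup.

(** * Comparison with a supersolution *)

Lemma near_finite (T : choiceType) (U : Type) (F : set_system U) {FF : Filter F}
    (D : set T) (P : U -> T -> Prop) : finite_set D ->
  (forall x, D x -> \forall h \near F, P h x) ->
  \forall h \near F, forall x, D x -> P h x.
Proof.
move=> /finite_fsetP[X ->] H.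
have := @filter_bigI U T X (fun x => [set h | P h x]) F FF H.
by apply: filterS => h hX x xX; exact: hX.
Qed.

Lemma expR_right_derivative (R : realType) (c t : R) :
  h^-1 * (expR (- c * (t + h)) - expR (- c * t)) @[h --> 0^'+]
    --> - c * expR (- c * t).
Proof.
have D : is_derive t 1 (fun s => expR (- c * s)) (- c * expR (- c * t)).
  have D1 : is_derive t 1 (fun s : R => - c * s) (- c).
    by apply: is_derive_eq; rewrite scaler1 ?mulr1.
  have := is_derive1_comp (is_derive_expR (- c * t)) D1.
  by rewrite mulrC.
have [D1 D2] := D; rewrite -D2.
apply: cvg_dnbhs_at_right.
rewrite (_ : (fun h => _) = fun h => h^-1 *: (((fun s => expR (- c * s)) \o shift t)
    (h *: (1 : R^o)) - expR (- c * t))); first exact: D1.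
apply/funext => h /=; congr (_ * (expR (_ * _) - _)).
by rewrite addrC [_ *: _]mulr1.
Qed.

(** The two properties of the generator of a jump process that matter below:
    linearity, and the minimum principle. *)
Record jump_generator (T : Type) (R : realType) (A : (T -> R) -> T -> R) : Prop :=
  JumpGenerator {
  jg_lin : forall f g c x, A (fun y => f y + c * g y) x = A f x + c * A g x;
  jg_min : forall f x, (forall y, f x <= f y) -> 0 <= A f x }.

Lemma jg_cst (T : Type) (R : realType) (A : (T -> R) -> T -> R) (c : R) (x : T) :
  jump_generator A -> A (fun=> c) x = 0.
Proof.
move=> [lin mn]; have h1 : 0 <= A (fun=> c) x by exact: mn.
have h2 : 0 <= A (fun=> - c) x by exact: mn.
have := lin (fun=> c) (fun=> - c) 1 x.
have -> : (fun _ : T => c + 1 * - c) = (fun _ => c + 1 * 0 + -1 * c).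
  by apply/funext => y; ring.
have := lin (fun=> c) (fun=> c) (-1) x.
have -> : (fun _ : T => c + 1 * 0 + -1 * c) = (fun _ => c + -1 * c).
  by apply/funext => y; ring.
lra.
Qed.

Section comparison.
Context (R : realType) (A : (state -> R) -> state -> R).
Variable p : R -> R.-pker state ~> state.
Hypothesis hp : transition_semigroup A p.
Hypothesis hA : jump_generator A.
Variables (V : state -> R) (C1 C2 : R).
Hypothesis C10 : 0 <= C1.
Hypothesis C20 : 0 < C2.
Hypothesis Vfin : forall M, finite_set [set x | V x <= M].
Hypothesis drift : forall x, A V x <= C1 - C2 * V x.

(** Only bounded functions f are covered by the backward equation, whereas V
    is unbounded; so V enters as a supersolution
      v t x = e^(- C2 t) (V x - K) + K,   K = C1 / C2,
    of the backward equation, compared with the bounded solution p_t f. As V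
    has finite sublevel sets and f is bounded, v - p_t f can only become
    negative at finitely many states, where the minimum principle applies. The
    term eps (1 + t) makes the differential inequality strict. *)
Lemma Et_drift f : bnd f -> (forall x, f x <= V x) ->
  forall t x, 0 <= t -> Et p t f x <= expR (- C2 * t) * V x + C1 / C2.
Proof.
move=> bf fV; set K := C1 / C2; have K0 : 0 <= K by rewrite divr_ge0// ltW.
have C2K : C2 * K = C1 by rewrite mulrC divfK// gt_eqF.
pose phi (t : R) := expR (- C2 * t).
pose w eps t x := phi t * (V x - K) + K - Et p t f x + eps * (1 + t).
suff main (eps : R) : 0 < eps -> forall t, 0 <= t -> forall x, 0 <= w eps t x.
  move=> t x t0; rewrite -lerBlDl; apply/ler_addgt0Pr => e e0.
  have t1 : 0 < 1 + t by rewrite ltr_wpDr.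
  have := main _ (divr_gt0 e0 t1) t t0 x.
  rewrite /w divfK ?gt_eqF//; have : 0 <= phi t * K by rewrite mulr_ge0// expR_ge0.
  by rewrite -/(phi t); lra.
move=> eps0; apply: real_induction.
- move=> x; rewrite /w /phi mulr0 expR0 mul1r subrK addr0 mulr1 (Et0 hp)//.
  by rewrite addr_ge0 ?(ltW eps0)// subr_ge0.
- move=> t t0 H x.
  have lim : w eps (t - h) x @[h --> 0^'+] --> w eps t x.
    have ch : h @[h --> 0^'+] --> (0 : R).
      by apply: cvg_within_filter; exact: cvg_id.
    have cth : t - h @[h --> 0^'+] --> t.
      by rewrite -[X in _ --> X]subr0; apply: cvgB; [exact: cvg_cst|exact: ch].
    apply: cvgD; last first.
      by apply: cvgM; [exact: cvg_cst|apply: cvgD; [exact: cvg_cst|exact: cth]].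
    apply: cvgB; last exact: (Et_left_cvg hp).
    apply: cvgD; last exact: cvg_cst.
    apply: cvgM; last exact: cvg_cst.
    apply: (cvg_comp (fun h => - C2 * (t - h)) expR); last exact: continuous_expR.
    by apply: cvgM; [exact: cvg_cst|exact: cth].
  apply: (cvgr_to_ge lim); near=> h; apply: H.
  have h0 : 0 < h by near: h; exact: nbhs_right_gt.
  have ht : h < t by near: h; exact: nbhs_right_lt.
  by rewrite subr_ge0 ltW//= ltrBlDr ltrDl.
- move=> t t0 wt; have [M fM] := bf.
  (* Above the level B of V the supersolution exceeds the bound of p_s f during
     the whole interval [t, t + 1]. *)
  pose B := K + `|M| * expR (C2 * (t + 1)).
  have far (h : R) x : 0 < h < 1 -> B < V x -> 0 <= w eps (t + h) x.
    move=> /andP[h0 h1] BV; rewrite /w.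
    have h2 : Et p (t + h) f x <= `|M|.
      by rewrite (le_trans (ler_norm _))// (le_trans (Et_norm p (t + h) fM x))// ler_norm.
    have h3 : `|M| <= phi (t + h) * (V x - K).
      have e1 : expR (- C2 * (t + 1)) <= phi (t + h).
        by rewrite ler_expR !mulNr lerN2 ler_wpM2l ?(ltW C20)// lerD2l ltW.
      have e2 : `|M| * expR (C2 * (t + 1)) <= V x - K by rewrite lerBrDl ltW.
      rewrite -[leLHS]mulr1 -(expRxMexpNx_1 (C2 * (t + 1))) mulrA mulrC -mulNr.
      by apply: ler_pM => //; rewrite ?expR_ge0// mulr_ge0// expR_ge0.
    have : 0 <= eps * (1 + (t + h)).
      by rewrite mulr_ge0 ?(ltW eps0)// !addr_ge0// ltW.
    lra.
  have near_x x : \forall h \near 0^'+, 0 <= w eps (t + h) x.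
    pose D := - C2 * phi t * (V x - K) - A (Et p t f) x + eps.
    have qD : h^-1 * (w eps (t + h) x - w eps t x) @[h --> 0^'+] --> D.
      have L : (h^-1 * (phi (t + h) - phi t)) * (V x - K)
          - h^-1 * (Et p (t + h) f x - Et p t f x) + eps @[h --> 0^'+] --> D.
        apply: cvgD; last exact: cvg_cst.
        apply: cvgB; last exact: (Et_backward hp).
        by apply: cvgM; [exact: expR_right_derivative|exact: cvg_cst].
      apply: (near_cvg L); near=> h.
      have h0 : 0 < h by near: h; exact: nbhs_right_gt.
      by rewrite /w; field; rewrite gt_eqF.
    (* At a zero of w, which is a minimum, the generator of w is nonnegative and
       the drift condition leaves at least eps. *)
    have D0 : w eps t x = 0 -> 0 < D.
      move=> w0; have mp : 0 <= A (w eps t) x.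
        by apply: (jg_min hA) => y; rewrite w0.
      have wE : w eps t = (fun y => ((phi t * - K + K + eps * (1 + t))
          + phi t * V y) + -1 * Et p t f y).
        by apply/funext => y; rewrite /w; ring.
      set c0 := _ + _ + _ in wE.
      rewrite wE (jg_lin hA (fun y => c0 + phi t * V y)) in mp.
      rewrite (jg_lin hA (fun=> c0)) (jg_cst _ _ hA) in mp.
      have := ler_wpM2l (expR_ge0 (- C2 * t)) (drift x); rewrite -/(phi t).
      rewrite -C2K /D; lra.
    have : 0 <= w eps t x by exact: wt.
    rewrite le_eqVlt => /orP[/eqP w0|w0].
      near=> h; have h0 : 0 < h by near: h; exact: nbhs_right_gt.
      have : 0 < h^-1 * (w eps (t + h) x - w eps t x).
        by near: h; apply: (cvgr_gt D qD); exact: D0.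
      by rewrite -w0 subr0 pmulr_rgt0 ?invr_gt0// => /ltW.
    have lim : h * (h^-1 * (w eps (t + h) x - w eps t x)) + w eps t x
        @[h --> 0^'+] --> 0 * D + w eps t x.
      apply: cvgD; last exact: cvg_cst.
      apply: cvgM; last exact: qD.
      by apply: cvg_within_filter; exact: cvg_id.
    rewrite mul0r add0r in lim.
    near=> h; have h0 : 0 < h by near: h; exact: nbhs_right_gt.
    rewrite -[w eps (t + h) x](subrK (w eps t x)).
    rewrite -[w eps (t + h) x - _](mulKf (_ : h != 0)) ?gt_eqF//.
    rewrite mulrCA; apply/ltW; near: h; apply: (cvgr_gt _ lim) => //.
  have nF := near_finite (P := fun h x => 0 <= w eps (t + h) x) (Vfin B)
    (fun x _ => near_x x).
  near=> h => x; have [VB|VB] := leP (V x) B.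
    by move: x VB; near: h; exact: nF.
  apply: far => //; apply/andP; split; near: h.
    exact: nbhs_right_gt.
  exact: nbhs_right_lt.
Unshelve. all: by end_near. Qed.

End comparison.

(** * Accessibility and limits of probabilities *)

Section positivity.
Context (R : realType) (A : (state -> R) -> state -> R).
Variable p : R -> R.-pker state ~> state.
Hypothesis hp : transition_semigroup A p.

Let hit (t : R) (x y : state) : R := Et p t \1_[set y] x.

Let hit_ge0 t x y : 0 <= hit t x y.
Proof.
rewrite -(mf_cst (Et_mean p t x) 0); apply: (mf_le (Et_mean p t x)).
- exact: bnd_cst.
- exact: bnd_indic.
- by move=> w; rewrite indicE.
Qed.

Let hitD s t x y z : 0 <= s -> 0 <= t -> hit s x y * hit t y z <= hit (s + t) x z.
Proof.
move=> s0 t0; have bz : bnd (\1_[set z] : state -> R) by exact: bnd_indic.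
have by_ : bnd (\1_[set y] : state -> R) by exact: bnd_indic.
rewrite /hit (EtD hp)// mulrC -(mf_scale (Et_mean p s x))//.
apply: (mf_le (Et_mean p s x)); last first.
- move=> w; rewrite indicE; have [->|wy] := pselect (w = y).
    by rewrite mem_set//= mulr1.
  by rewrite memNset//= mulr0; exact: hit_ge0.
- exact: (Et_bnd p t).
- have := bnd_lin (hit t y z) (bnd_cst state (0 : R)) by_.
  by under eq_fun do rewrite add0r.
Qed.

(** Short times are clear by continuity at 0, and a long time is a sum of short
    ones. *)
Lemma Et_stay_gt0 t x : 0 < t -> 0 < Et p t \1_[set x] x.
Proof.
move=> t0; have H : hit h x x @[h --> 0^'+] --> (1 : R).
  rewrite (_ : 1 = \1_[set x] x); last by rewrite indicE mem_set.
  by apply: (Et_cvg0 hp); exact: bnd_indic.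
have [e /= e0 He] : \forall h \near (0 : R)^'+, 0 < hit h x x.
  by apply: (cvgr_gt _ H); exact: ltr01.
have small s : 0 < s < e -> 0 < hit s x x.
  move=> /andP[s0 se]; apply: He => //=.
  by rewrite sub0r normrN gtr0_norm.
have mult s n : 0 < s < e -> 0 < hit (s *+ n.+1) x x.
  move=> se; have /andP[s0 _] := se; elim: n => [|n IH]; first exact: small.
  rewrite mulrS; apply: lt_le_trans (hitD _ _ _ (ltW s0) _).
    by apply: mulr_gt0; [exact: small|exact: IH].
  by rewrite mulrn_wge0// ltW.
have et : 0 < e / t by rewrite divr_gt0.
have [n] := ltr_add_invr et; rewrite add0r => Hn.
have n0 : 0 < n.+1%:R :> R by [].
rewrite (_ : t = (t / n.+1%:R) *+ n.+1); last first.
  by rewrite -mulr_natr divfK// gt_eqF.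
apply: mult; rewrite divr_gt0//=.
by rewrite mulrC -ltr_pdivlMr.
Qed.

(** One transition of positive rate, made at an early time, after which any
    target that is reachable from the new state at every time remains so. *)
Lemma Et_path_gt0 x y z : x <> y -> 0 < A \1_[set y] x ->
  (forall t : R, 0 < t -> 0 < Et p t \1_[set z] y) ->
  forall t : R, 0 < t -> 0 < Et p t \1_[set z] x.
Proof.
move=> xy Axy yz t t0.
have H := @ts_generator _ _ _ hp _ (bnd_indic R [set y]) x.
have nx : \1_[set y] x = 0 :> R by rewrite indicE memNset.
have [h [h0 ht hh]] : exists h, [/\ 0 < h, h < t & 0 < hit h x y].
  near (0 : R)^'+ => h; exists h.
  have h0 : 0 < h by near: h; exact: nbhs_right_gt.
  split => //.
  have : 0 < h^-1 * (hit h x y - \1_[set y] x).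
    by near: h; apply: (cvgr_gt _ H).
  by rewrite nx subr0 pmulr_rgt0// invr_gt0.
have th : 0 < t - h by rewrite subr_gt0.
rewrite -(subrK h t) addrC; apply: lt_le_trans (hitD x y z (ltW h0) (ltW th)).
by apply: mulr_gt0 => //; exact: yz.
Unshelve. all: by end_near. Qed.

End positivity.

Lemma finite_pos_lower_bound (R : realType) (T : choiceType) (D : set T)
    (f : T -> R) : finite_set D -> (forall x, D x -> 0 < f x) ->
  exists a : R, [/\ 0 < a, a <= 1 & forall x, D x -> a <= f x].
Proof.
move=> fD f0.
have nD := near_finite (F := (0 : R)^'+) (P := fun a x => a <= f x) fD
  (fun x Dx => nbhs_right_le (f0 x Dx)).
near (0 : R)^'+ => a; exists a; split.
- by near: a; exact: nbhs_right_gt.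
- by near: a; exact: nbhs_right_le.
- by near: a; exact: nD.
Unshelve. all: by end_near. Qed.

(** A set function that is a uniform limit of probabilities is a probability:
    uniformity exchanges the limit with countable sums. *)
Lemma uniform_limit_probability (R : realType) (mu : nat -> {measure set state -> \bar R})
    (l : set state -> R) (del : nat -> R) :
  (forall n, mu n setT = 1%E) -> del n @[n --> \oo] --> (0 : R) ->
  (forall n B, `|fine (mu n B) - l B| <= del n) ->
  exists pi : probability state R, forall B, pi B = (l B)%:E.
Proof.
move=> mu1 del0 hl.
have muf n B : mu n B = (fine (mu n B))%:E.
  have le1 : (mu n B <= 1)%E.
    by rewrite -(mu1 n) le_measure// inE; exact: measurable_state.
  by rewrite fineK// ge0_fin_numE// (le_lt_trans le1)// ltry.
have lim B : fine (mu n B) @[n --> \oo] --> l B.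
  apply/cvgrPdist_le => e e0; near=> n.
  rewrite distrC (le_trans (hl n B))//.
  by near: n; apply: (cvgr_le 0 del0).
have l0 : l set0 = 0.
  apply: (cvg_unique _ (lim set0)) => //.
  rewrite (_ : (fun n => _) = cst 0); first exact: cvg_cst.
  by apply/funext => n; rewrite measure0.
have lge0 B : 0 <= l B.
  by apply: (cvgr_to_ge (lim B)); apply: nearW => n; rewrite fine_ge0.
have lT : l setT = 1.
  apply: (cvg_unique _ (lim setT)) => //.
  rewrite (_ : (fun n => _) = cst 1); first exact: cvg_cst.
  by apply/funext => n; rewrite mu1.
have addU (phi : set state -> R) : phi set0 = 0 ->
    (forall B C, B `&` C = set0 -> phi (B `|` C) = phi B + phi C) ->
    forall (F : (set state)^nat) n, trivIset setT F ->
    \sum_(0 <= i < n) phi (F i) = phi (\big[setU/set0]_(0 <= i < n) F i).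
  move=> phi0 phiU F n tF; elim: n => [|n IH]; first by rewrite !big_nil phi0.
  rewrite !big_nat_recr//= IH phiU//.
  rewrite big_mkord; apply: (@trivIset_bigsetUI _ predT F _ n n) => //.
  by apply: sub_trivIset tF.
have muU n B C : B `&` C = set0 ->
    fine (mu n (B `|` C)) = fine (mu n B) + fine (mu n C).
  move=> BC; have -> : mu n (B `|` C) = (mu n B + mu n C)%E.
    by apply: measureU => //; exact: measurable_state.
  by rewrite (muf n B) (muf n C).
have lU B C : B `&` C = set0 -> l (B `|` C) = l B + l C.
  move=> BC; apply: (cvg_unique _ (lim (B `|` C))) => //.
  rewrite (_ : (fun n => _) = (fun n => fine (mu n B) + fine (mu n C))).
    by apply: cvgD; exact: lim.
  by apply/funext => n; exact: muU.
pose m B : \bar R := (l B)%:E.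
have m0 : m set0 = 0%E by rewrite /m l0.
have mge0 B : (0 <= m B)%E by rewrite lee_fin.
have msig : semi_sigma_additive m.
  move=> F mF tF mU; rewrite /m.
  rewrite (_ : (fun n => _) = EFin \o (fun n => \sum_(0 <= i < n) l (F i))); last first.
    by apply/funext => n; rewrite /= sumEFin.
  apply: cvg_EFin; first by apply: nearW.
  apply/cvgrPdist_le => e e0.
  have e3 : 0 < e / 3 by rewrite divr_gt0.
  have [k _ hk] : \forall k \near \oo, del k <= e / 3 by apply: (cvgr_le 0 del0).
  have {}hk := hk k (leqnn k).
  have sk : \sum_(0 <= i < n) fine (mu k (F i)) @[n --> \oo]
      --> fine (mu k (\bigcup_n F n)).
    have H : (\sum_(0 <= i < n) mu k (F i))%E @[n --> \oo]
        --> (fine (mu k (\bigcup_n F n)))%:E.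
      by rewrite -muf; exact: measure_semi_sigma_additive.
    rewrite (_ : (fun n => _) = fine \o (fun n => \sum_(0 <= i < n) mu k (F i))%E).
      exact: (fine_cvg H).
    apply/funext => n; rewrite /= (eq_bigr (fun i => (fine (mu k (F i)))%:E)).
      by rewrite sumEFin.
    by move=> i _; exact: muf.
  have /cvgrPdist_le /(_ _ e3) sk' := sk.
  near=> n.
  have h1 : `|fine (mu k (\bigcup_n F n)) - \sum_(0 <= i < n) fine (mu k (F i))| <= e / 3.
    by near: n; exact: sk'.
  rewrite /= (addU l)//.
  rewrite (addU (fun B => fine (mu k B))) ?measure0// in h1; last exact: muU.
  have h2 := le_trans (hl k (\bigcup_n F n)) hk.
  have h3 := le_trans (hl k (\big[setU/set0]_(0 <= i < n) F i)) hk.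
  by move: h1 h2 h3; rewrite !ler_norml => /andP[? ?] /andP[? ?] /andP[? ?];
    apply/andP; split; lra.
pose mM := isMeasure.Build _ _ _ m m0 mge0 msig.
pose M : {measure set state -> \bar R} := HB.pack m mM.
have M1 : M setT = 1%E by rewrite /M /= /m lT.
pose PM := Measure_isProbability.Build _ _ _ M M1.
pose P : probability state R := HB.pack (Measure.sort M) M PM.
by exists P.
Unshelve. all: by end_near. Qed.

(** * Harris' theorem *)

(** Harris' theorem for a semigroup of means with a Lyapunov function V and an
    accessible state z. Oscillations are measured against W = 1 + b V around an
    unspecified constant. *)
Section harris.
Context (R : realType) (A : (state -> R) -> state -> R).
Variable p : R -> R.-pker state ~> state.
Hypothesis hp : transition_semigroup A p.
Variables (V : state -> R) (K C2 : R) (z : state).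
Hypothesis V0 : forall x, 0 <= V x.
Hypothesis K0 : 0 <= K.
Hypothesis C20 : 0 < C2.
Hypothesis Vfin : forall M, finite_set [set x | V x <= M].
Hypothesis Vdrift : forall f, bnd f -> (forall x, f x <= V x) ->
  forall t x, 0 <= t -> Et p t f x <= expR (- C2 * t) * V x + K.
Hypothesis Vhit : forall t x, 0 < t -> 0 < Et p t \1_[set z] x.

(* With this step the factor e^(- C2 t0) = e^-7 of V is at most 1/8. *)
Let t0 := 7 / C2.
Let t00 : 0 < t0. Proof. by rewrite divr_gt0. Qed.

Let capV (N : R) (x : state) : R := Num.min (V x) N.

Let capV_bnd N : 0 <= N -> bnd (capV N).
Proof.
move=> N0; exists N => x; rewrite ger0_norm; first by rewrite ge_min lexx orbT.
by rewrite le_min V0.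
Qed.

Let capV_le N x : capV N x <= V x. Proof. by rewrite ge_min lexx. Qed.

(** The bound on g lets V be replaced by a truncation, which is all that the
    drift estimate covers. *)
Let cap_bound (D b : R) (g : state -> R) : 0 < D -> 0 < b -> bnd g ->
  (forall y, g y <= D * (1 + b * V y)) ->
  exists2 N, 0 <= N & forall y, g y <= D * (1 + b * capV N y).
Proof.
move=> D0 b0 [M gM] gV; exists (`|M| / (D * b)).
  by rewrite divr_ge0// mulr_ge0// ltW.
move=> y; rewrite /capV; have [h|h] := leP (V y) (`|M| / (D * b)).
  exact: gV.
have -> : D * (1 + b * (`|M| / (D * b))) = D + `|M|.
  by field; rewrite !gt_eqF.
rewrite (le_trans (ler_norm _))// (le_trans (gM y))// (le_trans (ler_norm _))//.
by rewrite lerDr ltW.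
Qed.

Let Et_weight (D b : R) (g : state -> R) t x : 0 < D -> 0 < b -> 0 <= t -> bnd g ->
  (forall y, g y <= D * (1 + b * V y)) ->
  Et p t g x <= D * (1 + b * (expR (- C2 * t) * V x + K)).
Proof.
move=> D0 b0 tge0 bg gV; have [N N0 gN] := cap_bound D0 b0 bg gV.
have bV := capV_bnd N0.
apply: (@le_trans _ _ (Et p t (fun y => D + D * b * capV N y) x)).
  apply: (mf_le (Et_mean p t x)) => //; first by apply: bnd_lin => //; exact: bnd_cst.
  by move=> y; rewrite (le_trans (gN y))// mulrDr mulr1 mulrA.
rewrite (mf_lin (Et_mean p t x))// ?(mf_cst (Et_mean p t x)); last exact: bnd_cst.
rewrite mulrDr mulr1 lerD2l mulrA ler_wpM2l//; first by rewrite mulr_ge0// ltW.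
exact: (Vdrift bV (capV_le N)).
Qed.

(** The mass that p_t0 puts on z is transported exactly, and the rest is bounded
    by the weight, whose value at z is at least D. *)
Let Et_weight_atom (D b a : R) (g : state -> R) x : 0 < D -> 0 < b -> bnd g ->
  (forall y, g y <= D * (1 + b * V y)) -> 0 <= a -> a <= Et p t0 \1_[set z] x ->
  Et p t0 g x - a * g z <= D * (1 + b * (expR (- C2 * t0) * V x + K)) - a * D.
Proof.
move=> D0 b0 bg gV a0 ax; have [N N0 gN] := cap_bound D0 b0 bg gV.
have bV := capV_bnd N0; have L := Et_mean p t0 x.
set W := fun y => D + D * b * capV N y.
have bW : bnd W by apply: bnd_lin => //; exact: bnd_cst.
have gW y : g y <= W y by rewrite (le_trans (gN y))// mulrDr mulr1 mulrA.
have WE : Et p t0 W x <= D * (1 + b * (expR (- C2 * t0) * V x + K)).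
  rewrite /W (mf_lin L)// ?(mf_cst L); last exact: bnd_cst.
  rewrite mulrDr mulr1 lerD2l mulrA ler_wpM2l//; first by rewrite mulr_ge0// ltW.
  exact: (Vdrift bV (capV_le N) _ (ltW t00)).
have DW : D <= W z.
  by rewrite lerDl !mulr_ge0// ?(ltW D0) ?(ltW b0)// le_min V0.
have : (W z - g z) * Et p t0 \1_[set z] x <= Et p t0 (fun y => W y + -1 * g y) x.
  rewrite -(mf_scale L); last exact: bnd_indic.
  apply: (mf_le L); [|exact: bnd_lin|].
    have := bnd_lin (W z - g z) (bnd_cst state (0 : R)) (bnd_indic R [set z]).
    by under eq_fun do rewrite add0r.
  move=> y; rewrite indicE; have [->|yz] := pselect (y = z).
    by rewrite mem_set//= mulr1 mulN1r.
  by rewrite memNset//= mulr0 mulN1r subr_ge0.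
rewrite (mf_lin L)// mulN1r => h.
have : a * (W z - g z) <= Et p t0 \1_[set z] x * (W z - g z).
  by rewrite ler_wpM2r// subr_ge0.
have : a * D <= a * W z by rewrite ler_wpM2l.
lra.
Qed.

Let exp_small : expR (- C2 * t0) <= 8^-1.
Proof.
rewrite /t0 mulNr mulrC divfK ?gt_eqF// expRN.
rewrite lef_pV2 ?posrE ?expR_gt0//; apply: le_trans (expR_ge1Dx _); lra.
Qed.

(** One step of length t0 contracts: on a sublevel set of V the mass a put on
    z is gained, outside it the drift dominates. The new centre is
    c + a (f z - c). *)
Let contraction : exists a b : R, [/\ 0 < a, a <= 1, 0 < b &
  forall D f c, 0 < D -> bnd f ->
  (forall x, `|f x - c| <= D * (1 + b * V x)) ->
  forall x, `|Et p t0 f x - (c + a * (f z - c))|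
     <= (1 - a / 4) * D * (1 + b * V x)].
Proof.
(* Choice of the level R0 and of the weight b: on V <= R0 the drift contributes
   at most b (R0 / 8 + K) <= 3 a / 4, less than the mass a gained at z; above R0
   the weight b V is at least 4 a, which pays for the constants of size a. *)
pose R0 := 16 * (K + V z) + 1.
have R01 : 1 <= R0 by rewrite lerDr mulr_ge0// addr_ge0.
have R00 : 0 < R0 by rewrite (lt_le_trans ltr01).
have [a [a0 a1 aH]] := finite_pos_lower_bound (Vfin R0)
  (fun x _ => Vhit x t00).
pose b := 4 * a / R0.
have b0 : 0 < b by rewrite divr_gt0// mulr_gt0.
have bR : b * R0 = 4 * a by rewrite divfK// gt_eqF.
have bKz : 16 * (b * K) + 16 * (b * V z) <= 4 * a.
  rewrite -bR -mulrDr -mulrDr mulrCA; apply: ler_wpM2l; first exact: ltW.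
  by rewrite lerDl.
have bK : 0 <= b * K by rewrite mulr_ge0// ltW.
have bz : 0 <= b * V z by rewrite mulr_ge0// ltW.
exists a, b; split => //.
have key D g : 0 < D -> bnd g -> (forall y, `|g y| <= D * (1 + b * V y)) ->
    forall x, Et p t0 g x - a * g z <= (1 - a / 4) * D * (1 + b * V x).
  move=> D0 bg gV x; have bV : 0 <= b * V x by rewrite mulr_ge0// ltW.
  have gV' y : g y <= D * (1 + b * V y) by rewrite (le_trans (ler_norm _)).
  have eV : b * (expR (- C2 * t0) * V x + K) <= b * V x / 8 + b * K.
    rewrite mulrDr lerD2r mulrCA (mulrC (expR _)).
    exact: (ler_wpM2l bV exp_small).
  rewrite (mulrC (1 - a / 4)) -mulrA.
  have [h|h] := leP (V x) R0.
    apply: (le_trans (Et_weight_atom D0 b0 bg gV' (ltW a0) (aH x h))).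
    rewrite (mulrC a) -mulrBr ler_wpM2l ?(ltW D0)//.
    have : b * V x <= 4 * a by rewrite -bR ler_wpM2l// ltW.
    move: eV; set e := b * (_ + K).
    have : 0 <= (1 - a / 4) * (b * V x) by rewrite mulr_ge0//; lra.
    rewrite mulrDr mulr1; lra.
  have Eg := Et_weight x D0 b0 (ltW t00) bg gV'.
  have ag : - (a * g z) <= D * (a * (1 + b * V z)).
    rewrite -mulrN mulrCA ler_wpM2l ?(ltW a0)//.
    by rewrite (le_trans (ler_norm _))// normrN.
  apply: (le_trans (lerD Eg ag)); rewrite -mulrDr ler_wpM2l ?(ltW D0)//.
  have bVx : 4 * a <= b * V x by rewrite -bR ler_wpM2l// ltW.
  have az : a * (b * V z) <= a / 4.
    rewrite ler_wpM2l ?(ltW a0)//; lra.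
  have aV : a / 4 * (b * V x) <= 4^-1 * (b * V x).
    by rewrite ler_wpM2r//; lra.
  move: eV; set e := b * (_ + K).
  rewrite !mulrDr !mulr1 (mulrBl (b * V x)) mul1r; lra.
move=> D f c D0 bf fc x.
have bg : bnd (fun y => f y - c).
  have := bnd_lin (-1) bf (bnd_cst state c).
  by under eq_fun do rewrite mulN1r.
have bgN : bnd (fun y => - (f y - c)).
  by have [M gM] := bg; exists M => y; rewrite normrN.
have h1 := key D _ D0 bg fc x.
have h2 := key D _ D0 bgN (fun y => etrans (congr1 (<=%R^~ _) (normrN _)) (fc y)) x.
have E1 : Et p t0 (fun y => f y - c) x = Et p t0 f x - c.
  exact: (mf_add_cst (Et_mean p t0 x) (- c) bf).
have E2 : Et p t0 (fun y => - (f y - c)) x = - (Et p t0 f x - c).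
  rewrite -E1; have := mf_scale (Et_mean p t0 x) (-1) bg; rewrite mulN1r => <-.
  by congr (Et p t0 _ x); apply/funext => y; rewrite mulN1r.
rewrite E1 in h1; rewrite E2 in h2.
by rewrite ler_norml; apply/andP; split; lra.
Qed.

(** Steps of length t0 give the factor (1 - a / 4)^k with k = floor (t / t0). A
    further p_u only averages the estimate, and V grows by at most K on average;
    so one constant c serves all later times. *)
Let decay : exists b C r : R, [/\ 0 < b, 0 < C, 0 < r &
  forall f, (forall x, `|f x| <= 1) -> forall t, 0 <= t -> exists c,
  forall s x, t <= s -> `|Et p s f x - c| <= C * expR (- r * t) * (1 + b * V x)].
Proof.
have [a [b [a0 a1 b0 H]]] := contraction.
have al0 : 0 < 1 - a / 4 by lra.
have bK : 0 <= b * K by rewrite mulr_ge0// ltW.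
exists b, (expR (a / 4) * (1 + b * K)), (a / 4 / t0); split => //.
- by rewrite mulr_gt0 ?expR_gt0// ltr_wpDr.
- by rewrite !divr_gt0.
move=> f f1 t tge0; have bf : bnd f by exists 1.
have steps k : exists c, forall x,
    `|Et p (k%:R * t0) f x - c| <= (1 - a / 4) ^+ k * (1 + b * V x).
  elim: k => [|k [c IH]].
    exists 0 => x; rewrite mul0r (Et0 hp)// subr0 expr0 mul1r (le_trans (f1 x))//.
    by rewrite lerDl mulr_ge0// ltW.
  exists (c + a * (Et p (k%:R * t0) f z - c)) => x.
  have kt0 : 0 <= k%:R * t0 by rewrite mulr_ge0// ltW.
  have -> : k.+1%:R * t0 = t0 + k%:R * t0 by rewrite -natr1 mulrDl mul1r addrC.
  rewrite exprS (EtD hp _ (ltW t00) kt0 bf).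
  by apply: H => //; [exact: exprn_gt0|exact: Et_bnd].
pose k := Num.truncn (t / t0).
have tt : 0 <= t / t0 by rewrite divr_ge0// ltW.
have /andP[k1 k2] := truncn_itv tt; rewrite -/k in k1 k2.
have [c hc] := steps k; exists c => s x ts.
have kt : k%:R * t0 <= t by rewrite -ler_pdivlMr.
have sk : 0 <= s - k%:R * t0 by rewrite subr_ge0 (le_trans kt).
set g := Et p (k%:R * t0) f in hc.
have bg : bnd g by exact: Et_bnd.
have kt0 : 0 <= k%:R * t0 by rewrite mulr_ge0// ltW.
have -> : Et p s f x = Et p (s - k%:R * t0) g x.
  by rewrite /g -(EtD hp)// subrK.
set u := s - k%:R * t0 in sk *.
set al := (1 - a / 4) ^+ k in hc.
have al_gt0 : 0 < al by exact: exprn_gt0.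
have ale : al <= expR (a / 4) * expR (- (a / 4 / t0) * t).
  have e1 : 1 - a / 4 <= expR (- (a / 4)) by rewrite -(opprK (a / 4)) opprK; exact: expR_ge1Dx.
  apply: (@le_trans _ _ (expR (- (a / 4)) ^+ k)).
    by rewrite /al lerXn2r// nnegrE ?expR_ge0// ltW.
  rewrite -expRM_natl -expRD ler_expR.
  have -> : - (a / 4 / t0) * t = - (a / 4) * (t / t0) by ring.
  have a4 : 0 < a / 4 by rewrite divr_gt0.
  move: k2; rewrite -natr1 => k2.
  have := ler_wpM2l (ltW a4) (ltW k2).
  rewrite mulrDr mulr1 mulNr mulrN (mulrC k%:R); lra.
have W1 : 0 <= 1 + b * V x by rewrite addr_ge0// mulr_ge0// ltW.
have step (h : state -> R) : bnd h -> (forall y, h y <= al * (1 + b * V y)) ->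
    Et p u h x <= expR (a / 4) * (1 + b * K) * expR (- (a / 4 / t0) * t) * (1 + b * V x).
  move=> bh hV; apply: (le_trans (Et_weight x al_gt0 b0 sk bh hV)).
  have -> : expR (a / 4) * (1 + b * K) * expR (- (a / 4 / t0) * t) * (1 + b * V x)
      = (expR (a / 4) * expR (- (a / 4 / t0) * t)) * ((1 + b * K) * (1 + b * V x)).
    by ring.
  apply: ler_pM => //; first exact: ltW.
    by rewrite addr_ge0// mulr_ge0 ?(ltW b0)// addr_ge0// mulr_ge0// expR_ge0.
  have eV : expR (- C2 * u) * V x <= V x.
    by rewrite ler_piMl// expR_le1 mulNr oppr_le0 mulr_ge0// ltW.
  have eV' := ler_wpM2l (ltW b0) eV.
  have bKV := mulr_ge0 bK (mulr_ge0 (ltW b0) (V0 x)).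
  by lra.
have bgc : bnd (fun y => g y - c).
  have := bnd_lin (-1) bg (bnd_cst state c).
  by under eq_fun do rewrite mulN1r.
have E1 : Et p u (fun y => g y - c) x = Et p u g x - c.
  exact: (mf_add_cst (Et_mean p u x) (- c) bg).
have E2 : Et p u (fun y => - (g y - c)) x = - (Et p u g x - c).
  rewrite -E1; have := mf_scale (Et_mean p u x) (-1) bgc; rewrite mulN1r => <-.
  by congr (Et p u _ x); apply/funext => y; rewrite mulN1r.
rewrite ler_norml lerNl -E2 -E1; apply/andP; split; apply: step => //.
- by have [M gM] := bgc; exists M => y; rewrite normrN.
- by move=> y; rewrite (le_trans (ler_norm _))// normrN.
- by move=> y; rewrite (le_trans (ler_norm _)).
Qed.

(** The constants around which p_t f oscillates converge, which gives a limit that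
    depends neither on the state nor on time. *)
Let limits : exists (M : state -> R) (r : R), [/\ forall x, 0 <= M x, 0 < r &
  forall f, (forall x, `|f x| <= 1) -> exists l, forall t x, 0 <= t ->
    `|Et p t f x - l| <= M x * expR (- r * t)].
Proof.
have [b [C [r [b0 C0 r0 H]]]] := decay.
have W1 x : 0 <= 1 + b * V x by rewrite addr_ge0// mulr_ge0// ltW.
exists (fun x => C * (1 + b * V x) + C * (1 + b * V z)), r; split => //.
  by move=> x; rewrite addr_ge0// mulr_ge0// ltW.
move=> f f1.
have cvgu : cvg (Et p n%:R f z @[n --> \oo]).
  apply/cauchy_cvgP/cauchy_exP => e e0.
  have Wz : 0 < C * (1 + b * V z) / e.
    by rewrite divr_gt0// mulr_gt0// ltr_wpDr// mulr_ge0// ltW.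
  (* At this time e^(r t) >= 1 + r t already exceeds C (1 + b V z) / e. *)
  pose t := C * (1 + b * V z) / e / r.
  have tge0 : 0 <= t by rewrite divr_ge0// ltW.
  have [c hc] := H f f1 t tge0; exists c.
  change (\forall n \near \oo, ball c e (Et p n%:R f z)).
  near=> n; rewrite /ball /= distrC.
  have tn : t <= n%:R by near: n; exact: nbhs_infty_ger.
  apply: (le_lt_trans (hc n%:R z tn)).
  have rt : r * t = C * (1 + b * V z) / e by rewrite mulrC divfK// gt_eqF.
  have : 1 + r * t <= expR (r * t) by exact: expR_ge1Dx.
  rewrite mulNr expRN rt => h.
  rewrite mulrAC ltr_pdivrMr ?expR_gt0//.
  have : e * (1 + C * (1 + b * V z) / e) <= e * expR (C * (1 + b * V z) / e).
    by rewrite ler_wpM2l// ltW.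
  by rewrite mulrDr mulr1 (mulrC e (_ / e)) divfK ?gt_eqF//; lra.
exists (lim (Et p n%:R f z @[n --> \oo])) => t x tge0.
have [c hc] := H f f1 t tge0.
have hl : `|c - lim (Et p n%:R f z @[n --> \oo])| <= C * expR (- r * t) * (1 + b * V z).
  have L : `|c - Et p n%:R f z| @[n --> \oo] --> `|c - lim (Et p n%:R f z @[n --> \oo])|.
    by apply: cvg_norm; apply: cvgB => //; exact: cvg_cst.
  apply: (cvgr_to_le L); near=> n; rewrite distrC; apply: hc.
  by near: n; exact: nbhs_infty_ger.
rewrite -[_ - lim _](subrKA c) (le_trans (ler_normD _ _))//.
rewrite mulrDl; apply: lerD; rewrite mulrAC; first exact: hc.
exact: hl.
Unshelve. all: by end_near. Qed.

Lemma harris_geometrically_ergodic : geometrically_ergodic p.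
Proof.
have [M [r [M0 r0 H]]] := limits.
have ind1 (B : set state) x : `|\1_B x| <= 1 :> R.
  by rewrite indicE; case: (_ \in _); rewrite ?normr1 ?normr0.
have [l hl] : exists l : set state -> R, forall B t x, 0 <= t ->
    `|Et p t \1_B x - l B| <= M x * expR (- r * t).
  have /choice [l hl] : forall B : set state, exists l, forall t x, 0 <= t ->
    `|Et p t \1_B x - l| <= M x * expR (- r * t) by move=> B; exact: H.
  by exists l.
pose del (n : nat) := M z * expR (- r * n%:R).
have del0 : del n @[n --> \oo] --> (0 : R).
  have Mz : 0 <= M z / r by rewrite divr_ge0// ltW.
  apply/cvgrPdist_le => e e0; near=> n.
  rewrite sub0r normrN /del ger0_norm ?mulr_ge0 ?expR_ge0//.
  rewrite mulNr expRN ler_pdivrMr ?expR_gt0//.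
  have : M z / e / r <= n%:R by near: n; exact: nbhs_infty_ger.
  rewrite ler_pdivrMr// => h.
  have : 1 + r * n%:R <= expR (r * n%:R) by exact: expR_ge1Dx.
  rewrite ler_pdivrMr// in h => h2.
  apply: (le_trans h); rewrite mulrC ler_wpM2l ?(ltW e0)// mulrC; lra.
have [pi hpi] : exists pi : probability state R, forall B, pi B = (l B)%:E.
  apply: (@uniform_limit_probability _ (fun n => p n%:R z) l del) => //.
    by move=> n; exact: prob_kernel.
  by move=> n B; rewrite -Et_indic; exact: hl.
exists pi, M, r; split => //; last first.
  by move=> t x B t0' mB; rewrite p_fin hpi -EFinB lee_fin; exact: hl.
move=> t B tge0 mB.
have Lpi := mean_measure_state (probability_setT pi).
pose g := Et p t \1_B.
have bg : bnd g by apply: Et_bnd; exact: bnd_indic.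
have g01 x : 0 <= g x <= 1.
  apply: (mf_bounds (Et_mean p t x)) => y; rewrite indicE.
  by case: (_ \in _); rewrite ler01 ?lexx.
transitivity ((\int[pi]_x g x)%R%:E).
  under eq_integral do rewrite p_fin.
  rewrite /Rintegral fineK//; apply: integrable_fin_num => //.
  by apply: integrable_bnd => //; [exact: probability_setT|exact: measurable_fun_state].
rewrite hpi; congr EFin; apply/eqP; rewrite -subr_eq0 -normr_le0.
suff dn n : `|(\int[pi]_x g x)%R - l B| <= 2 * del n.
  have L2 : 2 * del n @[n --> \oo] --> (2 * 0 : R).
    by apply: cvgM; [exact: cvg_cst|exact: del0].
  rewrite mulr0 in L2; apply: (cvgr_to_ge L2).
  by apply: nearW => n; exact: dn.
have ln : `|Et p n%:R g z - l B| <= del n.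
  rewrite /g -(EtD hp)//; last exact: bnd_indic.
  apply: (le_trans (hl B (n%:R + t) z _)); first by rewrite addr_ge0.
  rewrite /del ler_wpM2l// ler_expR !mulNr lerN2 ler_wpM2l// ?(ltW r0)//.
  by rewrite lerDl.
have Ln := Et_mean p n%:R z.
have piB C : (\int[pi]_x \1_C x)%R = l C.
  rewrite (Rintegral_indic _ (measurable_state C)).
  exact: (congr1 fine (hpi C)).
have h1 C : (\int[pi]_x \1_C x)%R <= Et p n%:R \1_C z + del n.
  rewrite piB; have := hl C n%:R z (ler0n _ _).
  by rewrite ler_norml => /andP[? ?]; rewrite /del; lra.
have h2 C : Et p n%:R \1_C z <= (\int[pi]_x \1_C x)%R + del n.
  rewrite piB; have := hl C n%:R z (ler0n _ _).
  by rewrite ler_norml => /andP[? ?]; rewrite /del; lra.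
have i1 : (\int[pi]_x g x)%R <= Et p n%:R g z + del n.
  exact: (mf_indic_le Lpi Ln h1 g01).
have i2 : Et p n%:R g z <= (\int[pi]_x g x)%R + del n.
  exact: (mf_indic_le Ln Lpi h2 g01).
by move: ln; rewrite !ler_norml => /andP[? ?]; apply/andP; split; lra.
Unshelve. all: by end_near. Qed.

End harris.

(** * Time averages along sample paths *)

Section sample_paths.
Context (R : realType) (p : R -> R.-pker state ~> state).
Context (d : measure_display) (T : measurableType d) (P : probability T R).
Variables (X : R -> T -> state) (x0 : state).
Hypothesis hX : markov_process p P X.
Hypothesis hX0 : forall w, X 0 w = x0.

Lemma markov_law t (B : set state) : 0 <= t -> P (X t @^-1` B) = p t x0 B.
Proof.
move=> t0; have mB := measurable_state B.
have ET : <<s past_events X 0 >> setT.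
  apply: sub_sigma_algebra; by exists 0, setT; split.
have := mp_markov hX (lexx 0) t0 ET mB.
rewrite setTI add0r => ->.
under eq_integral do rewrite hX0.
rewrite p_fin integral_cst// [X in (_ * X)%E](_ : _ = 1%E) ?mule1//.
exact: probability_setT.
Qed.

Lemma markov_mean t (g : state -> R) : 0 <= t -> (forall x, 0 <= g x) ->
  (\int[P]_w (g (X t w))%:E = \int[p t x0]_y (g y)%:E)%E.
Proof.
move=> t0 g0; have mX := mp_measurable hX t0.
have mg : measurable_fun setT (EFin \o g) by exact: measurable_fun_state.
have H := @ge0_integral_pushforward _ _ _ _ _ _ mX P setT (EFin \o g)
  measurableT mg (fun y _ => g0 y).
rewrite preimage_setT in H; rewrite -[LHS]/(\int[P]_w ((EFin \o g) \o X t) w)%E -H.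
apply: eq_measure_integral => B mB _; exact: markov_law.
Qed.

(** By right-continuity X s is the limit of the values of X at the next point of
    the grid of mesh 1/(k+1), and for a fixed k these involve only countably many
    of the measurable maps X t. *)
Lemma path_measurable (f : state -> R) :
  measurable_fun setT (fun z : R * T => f (X (Num.max z.1 0) z.2)).
Proof.
pose tk (k : nat) (s : R) : R := (Num.truncn (Num.max s 0 * k.+1%:R)).+1%:R / k.+1%:R.
apply: (@measurable_fun_cvg _ _ _ _ (fun k z => f (X (tk k z.1) z.2))).
- move=> k _ Y mY; rewrite setTI.
  pose J i : set R := [set s | Num.truncn (Num.max s 0 * k.+1%:R) = i].
  pose F i : set T := (fun w => f (X (i.+1%:R / k.+1%:R) w)) @^-1` Y.
  rewrite (_ : _ @^-1` Y = \bigcup_i (J i `*` F i)); last first.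
    apply/seteqP; split => [[s w] /= H|[s w] [i _ [/= <-]]//].
    by exists (Num.truncn (Num.max s 0 * k.+1%:R)).
  apply: bigcup_measurable => i _; apply: measurableX.
    have mm : measurable_fun setT (fun s : R => Num.max s 0 * k.+1%:R).
      by apply: measurable_funM => //; exact: measurable_maxr.
    rewrite (_ : J i = (fun s : R => Num.max s 0 * k.+1%:R) @^-1`
        `[i%:R, i.+1%:R[%classic).
      by rewrite -[X in measurable X]setTI; apply: mm.
    have ge s : 0 <= Num.max s 0 * k.+1%:R :> R.
      by rewrite mulr_ge0// le_max lexx orbT.
    apply/seteqP; split => s /=; rewrite /J /= in_itv /=.
      by move=> <-; exact: truncn_itv.
    by move=> h; apply: truncn_def.
  have mX := mp_measurable hX (_ : 0 <= i.+1%:R / k.+1%:R).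
  have mfX : measurable_fun setT (fun w => f (X (i.+1%:R / k.+1%:R) w)).
    apply: (measurableT_comp (f := f)); first exact: measurable_fun_state.
    by apply: mX; rewrite divr_ge0.
  by rewrite -[F i]setTI; exact: mfX.
- move=> [s w] _ /=; set t := Num.max s 0.
  have t0 : 0 <= t by rewrite le_max lexx orbT.
  have [e /= e0 He] := mp_right_continuous hX w t0.
  apply: cvg_near_cst; near=> k.
  have k0 : 0 < k.+1%:R :> R by [].
  have tk0 : 0 <= t * k.+1%:R by rewrite mulr_ge0.
  have /andP[h1 h2] := truncn_itv tk0.
  have tlt : t < tk k s by rewrite /tk ltr_pdivlMr.
  congr f; apply: He => //=.
  rewrite ltr0_norm ?subr_lt0// opprB ltrBlDl.
  apply: (@le_lt_trans _ _ (t + k.+1%:R^-1)); last first.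
    by rewrite ltrD2l; near: k; exact: (near_infty_natSinv_lt (PosNum e0)).
  rewrite /tk ler_pdivrMr// mulrDl mulVf ?gt_eqF// -natr1 lerD2r.
  exact: h1.
Unshelve. all: by end_near. Qed.

Lemma time_average_le (g : state -> R) (K S : R) : (forall x, 0 <= g x) ->
  0 <= K -> 0 < S ->
  (forall t, 0 <= t -> (\int[p t x0]_y (g y)%:E <= K%:E)%E) ->
  ((S^-1)%:E * \int[P]_w \int[@lebesgue_measure R]_(s in `[0%R, S]) (g (X s w))%:E
    <= K%:E)%E.
Proof.
move=> g0 K0 S0 gK.
pose h (z : R * T) : \bar R :=
  (\1_(`[0, S]%classic) z.1 * g (X (Num.max z.1 0) z.2))%:E.
have mh : measurable_fun setT h.
  apply/measurable_EFinP; apply: measurable_funM; last exact: path_measurable.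
  by apply: (measurableT_comp (f := \1_(`[0, S]%classic) : R -> R)).
have h0 z : (0 <= h z)%E.
  by rewrite lee_fin mulr_ge0// indicE.
have -> : (\int[P]_w \int[@lebesgue_measure R]_(s in `[0%R, S]) (g (X s w))%:E
    = \int[P]_w \int[@lebesgue_measure R]_s h (s, w))%E.
  apply: eq_integral => w _; rewrite integral_mkcond; apply: eq_integral => s _.
  rewrite patchE /h /= indicE; case: ifPn => [|_]; last by rewrite mul0r.
  by rewrite inE /= in_itv /= => /andP[s0 _]; rewrite mul1r max_l.
have -> : (\int[P]_w \int[@lebesgue_measure R]_s h (s, w)
    = \int[@lebesgue_measure R]_s \int[P]_w h (s, w))%E.
  exact/esym/fubini_tonelli.
apply: (@le_trans _ _ ((S^-1)%:E * \int[@lebesgue_measure R]_s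
    (K * \1_(`[0, S]%classic) s)%:E)%E).
  rewrite lee_pmul2l// ?lte_fin ?invr_gt0//.
  apply: ge0_le_integral => //.
  - by move=> s _; apply: integral_ge0 => w _; exact: h0.
  - exact: measurable_fun_fubini_tonelli_F.
  - by apply/measurable_EFinP; apply: measurable_funM.
  move=> s _; rewrite /h /= indicE; case: (boolP (s \in _)) => [|_]; last first.
    by rewrite mulr0; under eq_integral do rewrite mul0r; rewrite integral0.
  rewrite inE /= in_itv /= => /andP[s0 _]; rewrite mulr1 max_l//.
  under eq_integral do rewrite mul1r.
  by rewrite markov_mean//; exact: gK.
under eq_integral do rewrite EFinM.
rewrite ge0_integralZl_EFin//; first last.
- by apply/measurable_EFinP.
have lS : @lebesgue_measure R `[0, S]%classic = S%:E.
  by rewrite lebesgue_measure_itv /= lte_fin S0 sube0.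
rewrite integral_indic// setIT [X in (_ * (_ * X))%E](_ : _ = S%:E)//.
by rewrite -!EFinM lee_fin mulrCA mulVf ?gt_eqF// mulr1.
Qed.

Lemma ergodic_mean_le (g : R -> T -> R) (K : R) :
  (forall S : R, 0 < S -> ((S^-1)%:E *
     \int[P]_w \int[@lebesgue_measure R]_(s in `[0%R, S]) (g s w)%:E <= K%:E)%E) ->
  (ergodic_mean P g <= K%:E)%E.
Proof.
move=> H; rewrite /ergodic_mean /limf_esup.
apply: (@le_trans _ _ (ereal_sup ((fun S : R => (S^-1)%:E *
  \int[P]_w \int[@lebesgue_measure R]_(s in `[0%R, S]) (g s w)%:E)%E
  @` [set S | 0 < S]))).
  apply: ereal_inf_lbound; exists [set S | 0 < S] => //.
  by exists 0; split => //.
by apply: ub_ereal_sup => _ [S /= S0 <-]; exact: H.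
Qed.

End sample_paths.

(** * Moments, accessibility and growth for the network *)

(** From the truncations covered by the drift estimate to unbounded functions,
    by monotone convergence. *)
Lemma moment_bound (R : realType) (p : R -> R.-pker state ~> state)
    (V g : state -> R) (K C2 G : R) :
  0 < C2 -> (forall x, 0 <= V x) ->
  (forall f, bnd f -> (forall x, f x <= V x) ->
    forall t x, 0 <= t -> Et p t f x <= expR (- C2 * t) * V x + K) ->
  0 < G -> (forall x, 0 <= g x <= G * (1 + V x)) ->
  forall t x, 0 <= t ->
  (\int[p t x]_y (g y)%:E <= (G * (1 + V x + K))%:E)%E.
Proof.
move=> C20 V0 Vdrift G0 gV t x t0.
have g0 y : 0 <= g y by case/andP: (gV y).
pose gN (N : nat) y := Num.min (g y) N%:R.
have gN0 N y : 0 <= gN N y by rewrite le_min g0/=.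
have bN N : bnd (gN N).
  by exists N%:R => y; rewrite ger0_norm// ge_min lexx orbT.
have EN N : Et p t (gN N) x <= G * (1 + V x + K).
  have bf : bnd (fun y => -1 + G^-1 * gN N y) by apply: bnd_lin => //; exact: bnd_cst.
  have fV y : -1 + G^-1 * gN N y <= V y.
    rewrite addrC lerBlDr ler_pdivrMl//; case/andP: (gV y) => _; rewrite addrC.
    by apply: le_trans; rewrite ge_min lexx.
  have := Vdrift _ bf fV t x t0.
  rewrite (mf_lin (Et_mean p t x))//; last exact: bnd_cst.
  rewrite (mf_cst (Et_mean p t x)) addrC lerBlDr ler_pdivrMl// => /le_trans; apply.
  rewrite ler_wpM2l ?(ltW G0)//.
  have : expR (- C2 * t) * V x <= V x.
    by rewrite ler_piMl// expR_le1 mulNr oppr_le0 mulr_ge0// ltW.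
  lra.
have lim y : limn (fun N => (gN N y)%:E) = (g y)%:E.
  apply: cvg_lim => //; apply: cvg_near_cst; near=> N.
  congr EFin; apply: min_l; near: N; exact: nbhs_infty_ger.
under eq_integral do rewrite -lim.
have H := @cvg_monotone_convergence _ _ _ (p t x) setT measurableT
  (fun N y => (gN N y)%:E).
have cv : (\int[p t x]_y (gN N y)%:E)%E @[N --> \oo]
    --> (\int[p t x]_y (limn (fun N => (gN N y)%:E)))%E.
  apply: H.
  - by move=> N; exact: measurable_fun_state.
  - by move=> N y _; rewrite lee_fin.
  - move=> y _ N M NM; rewrite lee_fin le_min ge_min lexx/= ge_min.
    by rewrite ler_nat NM orbT.
have Pf N : (\int[p t x]_y (gN N y)%:E)%E = (Et p t (gN N) x)%:E.
  rewrite /Et /Rintegral fineK//; apply: integrable_fin_num => //.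
  by apply: integrable_bnd => //; [exact: prob_kernel|exact: measurable_fun_state].
rewrite -(cvg_lim _ cv)//; apply: lime_le; first by apply/cvg_ex; eexists; exact: cv.
by apply: nearW => N; rewrite Pf lee_fin.
Unshelve. all: by end_near. Qed.

Lemma gen_jump_generator (R : realType) (a : network R) (L : limits R) n :
  rates_ge0 a -> jump_generator (gen a L n).
Proof.
move=> /(_ n) [[l1 l2 g1 g2] [m1 m2 m3]]; split.
  by move=> f g c x; rewrite /gen; ring.
move=> f x fx; rewrite /gen.
by rewrite !addr_ge0// mulr_ge0// ?subr_ge0// ?addr_ge0// ?mulr_ge0.
Qed.

Lemma gen_down1_gt0 (R : realType) (a : network R) (L : limits R) c K n x1 x2 :
  rates_ge0 a -> 0 < c -> regime a L c K n ->
  0 < gen a L n \1_[set (x1, x2)] (x1.+1, x2).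
Proof.
move=> /(_ n) [[l1 l2 g1 g2] [m1 m2 m3]] c0 rg.
have [s1 _] := class1_split (x1.+1, x2) (rg_pools rg).
have fx : \1_[set (x1, x2)] (x1.+1, x2) = 0 :> R.
  by rewrite indicE memNset//= => -[]; lia.
have fy : \1_[set (x1, x2)] (x1, x2) = 1 :> R by rewrite indicE mem_set.
rewrite /gen /= fx fy !subr0 !mulr1.
set z1 := z11 _ _ _ in s1 *; set z2 := z12 _ _ _ _ in s1 *.
set q := q1 _ _ _ _ in s1 *.
have rate : 0 < mu11 a n * z1%:R + mu12 a n * z2%:R + gam1 a n * q%:R.
  have h1 := proj1 (andP (rg_mu11 rg)); have h2 := proj1 (andP (rg_mu12 rg)).
  have h3 := proj1 (andP (rg_gam1 rg)).
  apply: (@lt_le_trans _ _ (c * z1%:R + c * z2%:R + c * q%:R)).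
    by rewrite -!mulrDr -!natrD s1 mulr_gt0.
  by apply: lerD; [apply: lerD|]; apply: ler_wpM2r.
have i0 y : 0 <= \1_[set (x1, x2)] y :> R by rewrite indicE.
have t1 := mulr_ge0 l1 (i0 (x1.+2, x2)).
have t2 := mulr_ge0 l2 (i0 (x1.+1, x2.+1)).
have t3 : 0 <= mu22 a n * (z22 a L n (x1.+1, x2))%:R * \1_[set (x1, x2)] (x1.+1, x2.-1).
  by rewrite !mulr_ge0.
have t4 : 0 <= gam2 a n * (q2 a L n (x1.+1, x2))%:R * \1_[set (x1, x2)] (x1.+1, x2.-1).
  by rewrite !mulr_ge0.
lra.
Qed.

Lemma gen_down2_gt0 (R : realType) (a : network R) (L : limits R) c K n x1 x2 :
  rates_ge0 a -> 0 < c -> regime a L c K n ->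
  0 < gen a L n \1_[set (x1, x2)] (x1, x2.+1).
Proof.
move=> /(_ n) [[l1 l2 g1 g2] [m1 m2 m3]] c0 rg.
have [s1 _] := class2_split (x1, x2.+1) (rg_pools rg).
have fx : \1_[set (x1, x2)] (x1, x2.+1) = 0 :> R.
  by rewrite indicE memNset//= => -[]; lia.
have fy : \1_[set (x1, x2)] (x1, x2) = 1 :> R by rewrite indicE mem_set.
rewrite /gen /= fx fy !subr0 !mulr1.
set z := z22 _ _ _ _ in s1 *; set q := q2 _ _ _ _ in s1 *.
have rate : 0 < mu22 a n * z%:R + gam2 a n * q%:R.
  have h1 := proj1 (andP (rg_mu22 rg)); have h3 := proj1 (andP (rg_gam2 rg)).
  apply: (@lt_le_trans _ _ (c * z%:R + c * q%:R)).
    by rewrite -!mulrDr -!natrD s1 mulr_gt0.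
  by apply: lerD; apply: ler_wpM2r.
have i0 y : 0 <= \1_[set (x1, x2)] y :> R by rewrite indicE.
have t1 := mulr_ge0 l1 (i0 (x1.+1, x2.+1)).
have t2 := mulr_ge0 l2 (i0 (x1, x2.+2)).
have t3 : 0 <= (mu11 a n * (z11 a n (x1, x2.+1))%:R
    + mu12 a n * (z12 a L n (x1, x2.+1))%:R) * \1_[set (x1, x2)] (x1.-1, x2.+1).
  by rewrite mulr_ge0// addr_ge0// mulr_ge0.
have t4 : 0 <= gam1 a n * (q1 a L n (x1, x2.+1))%:R * \1_[set (x1, x2)] (x1.-1, x2.+1).
  by rewrite !mulr_ge0.
lra.
Qed.

(** The empty system is accessible: departures alone empty the network. *)
Lemma hit_empty_gt0 (R : realType) (a : network R) (L : limits R) c K n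
    (p : R -> R.-pker state ~> state) :
  rates_ge0 a -> 0 < c -> regime a L c K n ->
  transition_semigroup (gen a L n) p ->
  forall (t : R) x, 0 < t -> 0 < Et p t \1_[set (0%N, 0%N)] x.
Proof.
move=> ra c0 rg hp t [x1 x2] t0.
elim: x1 t t0 => [|x1 IH] t t0; last first.
  apply: (Et_path_gt0 hp (y := (x1, x2))) => //; first by case; lia.
  exact: gen_down1_gt0 rg.
elim: x2 t t0 => [|x2 IH] t t0; first exact: (Et_stay_gt0 hp).
apply: (Et_path_gt0 hp (y := (0%N, x2))) => //; first by case; lia.
exact: gen_down2_gt0 rg.
Qed.

Lemma lyap_ge0 (R : realType) (k beta : R) x : 0 < beta -> 0 <= lyap k beta x.
Proof. by move=> b0; rewrite addr_ge0 ?powR_ge0// mulr_ge0 ?powR_ge0// ltW. Qed.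

Lemma powR_le_bound (R : realType) (k u B : R) : 1 <= k -> 0 <= u -> u `^ k <= B ->
  u <= 1 + B.
Proof.
move=> k1 u0 uB; have [u1|u1] := leP u 1.
  by rewrite (le_trans u1)// lerDl (le_trans _ uB)// powR_ge0.
rewrite (le_trans (le1r_powR (ltW u1) k1))// (le_trans uB)// lerDr//.
Qed.

Lemma lyap_sublevel_finite (R : realType) (L : limits R) (k beta : R) n :
  (0 < n)%N -> 1 <= k -> 0 < beta ->
  forall M : R, finite_set [set x : state | lyap k beta (xhat L n x) <= M].
Proof.
move=> n0 k1 b0 M; have s0 : 0 < Num.sqrt n%:R :> R by rewrite sqrtr_gt0 ltr0n.
have coord (X B : R) : exists N : nat, forall m : nat,
    `|(m%:R - n%:R * X) / Num.sqrt n%:R| `^ k <= B -> (m < N)%N.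
  exists (Num.truncn (n%:R * X + Num.sqrt n%:R * (1 + B))).+1 => m /(powR_le_bound k1) H.
  rewrite ltnS; have {}H := H (normr_ge0 _).
  have {}H := le_trans (ler_norm _) H.
  rewrite ler_pdivrMr// lerBlDl (mulrC (1 + B)) in H.
  by rewrite truncn_ge_nat// (le_trans _ H).
have [N1 H1] := coord (xstar L).1 M; have [N2 H2] := coord (xstar L).2 (M / beta).
apply: (@sub_finite_set _ _ (`I_N1 `*` `I_N2)); last first.
  by apply: finite_setX; exact: finite_II.
move=> [m1 m2]; rewrite /lyap /xhat /= => H; split => /=.
  by apply: H1; apply: le_trans H; rewrite lerDl mulr_ge0 ?powR_ge0// ltW.
by apply: H2; rewrite ler_pdivlMr// mulrC; apply: le_trans H; rewrite lerDr powR_ge0.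
Qed.

Lemma enorm_le (R : realType) (u : R * R) : enorm u <= `|u.1| + `|u.2|.
Proof.
have s0 : 0 <= `|u.1| + `|u.2| by rewrite addr_ge0.
rewrite /enorm -[leRHS]ger0_norm// -sqrtr_sqr ler_wsqrtr// sqrrD.
rewrite !real_normK ?num_real//.
by have : 0 <= `|u.1| * `|u.2| by []; lra.
Qed.

Lemma fst_le_enorm (R : realType) (u : R * R) : `|u.1| <= enorm u.
Proof. by rewrite -sqrtr_sqr ler_wsqrtr// lerDl sqr_ge0. Qed.

Lemma snd_le_enorm (R : realType) (u : R * R) : `|u.2| <= enorm u.
Proof. by rewrite -sqrtr_sqr ler_wsqrtr// lerDr sqr_ge0. Qed.

(** Queues and idle servers are controlled by the state, since the policy
    idles or queues only on the wrong side of the staffing levels. *)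
Lemma queue_idle_growth (R : realType) (a : network R) (L : limits R) (c K : R) n x :
  regime a L c K n -> 0 <= K ->
  let r := 1 + `|(xhat L n x).1| + `|(xhat L n x).2| in
  [/\ enorm (xhat L n x) <= (3 + 3 * K) * r,
      enorm (qhat a L n x) <= (3 + 3 * K) * r &
      enorm (yhat a L n x) <= (3 + 3 * K) * r].
Proof.
move=> rg K0 r.
have n0 := rg_n rg; have s0 : 0 < Num.sqrt n%:R :> R by rewrite sqrtr_gt0 ltr0n.
have [hq1 hq2 hy1 hy2] := queues_idle_le x (rg_pools rg).
set N1 := (srv1 a n + srv12 a L n)%N in hq1 hy1 hy2.
set N2 := srv22 a L n in hq2 hy2.
set s := Num.sqrt n%:R in s0.
have sub_le (m N : nat) : (m - N)%:R <= `|m%:R - N%:R| :> R.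
  have [h|h] := leqP m N; first by rewrite (eqP h); exact: normr_ge0.
  by rewrite natrB ?(ltnW h)// ler_norm.
have dist (m N : nat) (X : R) : `|N%:R - n%:R * X| <= K * s ->
    `|m%:R - N%:R| / s <= `|(m%:R - n%:R * X) / s| + K.
  move=> h; rewrite normrM normfV (gtr0_norm s0) ler_pdivrMr// mulrDl divfK ?gt_eqF//.
  rewrite -[m%:R - N%:R](subrKA (n%:R * X)) (le_trans (ler_normD _ _))// lerD2l.
  by rewrite distrC.
have d1 : `|x.1%:R - N1%:R| / s <= `|(xhat L n x).1| + K by apply: dist; exact: rg_stf1 rg.
have d2 : `|x.2%:R - N2%:R| / s <= `|(xhat L n x).2| + K by apply: dist; exact: rg_stf2 rg.
have up (q m N : nat) : (q <= m - N)%N -> q%:R / s <= `|m%:R - N%:R| / s.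
  move=> h; rewrite ler_pM2r ?invr_gt0//; apply: le_trans (sub_le m N).
  by rewrite ler_nat.
have b1 := le_trans (up _ _ _ hq1) d1; have b2 := le_trans (up _ _ _ hq2) d2.
have b3 : (y1 a n x)%:R / s <= `|(xhat L n x).1| + K.
  by apply: le_trans d1; rewrite distrC; exact: up.
have b4 : (y2 a L n x)%:R / s <= `|(xhat L n x).1| + K + (`|(xhat L n x).2| + K).
  apply: le_trans (lerD d1 d2); rewrite -mulrDl ler_pM2r ?invr_gt0//.
  apply: (@le_trans _ _ ((N1 - x.1) + (N2 - x.2))%:R); first by rewrite ler_nat.
  by rewrite natrD; apply: lerD; rewrite distrC.
have e1 := enorm_le (xhat L n x).
have pos (m : nat) : `|m%:R / s| = m%:R / s by rewrite ger0_norm// divr_ge0// ltW.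
have e2 : enorm (qhat a L n x) <= (q1 a L n x)%:R / s + (q2 a L n x)%:R / s.
  by rewrite -(pos (q1 _ _ _ _)) -(pos (q2 _ _ _ _)); exact: enorm_le.
have e3 : enorm (yhat a L n x) <= (y1 a n x)%:R / s + (y2 a L n x)%:R / s.
  by rewrite -(pos (y1 _ _ _)) -(pos (y2 _ _ _ _)); exact: enorm_le.
rewrite /r; move: b1 b2 b3 b4 e1 e2 e3.
set u := `|(xhat L n x).1|; set v := `|(xhat L n x).2| => b1 b2 b3 b4 e1 e2 e3.
have u0 : 0 <= u by exact: normr_ge0.
have v0 : 0 <= v by exact: normr_ge0.
have Ku := mulr_ge0 K0 u0; have Kv := mulr_ge0 K0 v0.
clear -b1 b2 b3 b4 e1 e2 e3 u0 v0 Ku Kv K0; split; lra.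
Qed.

(** Any power of a quantity of linear growth is dominated by a Lyapunov function
    of at least the same degree. *)
Lemma growth_power (R : realType) (k k' D : R) : 0 < k -> k <= k' -> 1 <= k' ->
  1 <= D -> exists2 G : R, 0 < G & forall a b u : R, 0 <= u ->
  u <= D * (1 + `|a| + `|b|) -> u `^ k <= G * (1 + lyap k' 1 (a, b)).
Proof.
move=> k0 kk' k1 D1; have D0 : 0 < D by rewrite (lt_le_trans ltr01).
have k'0 : 0 <= k' by rewrite (le_trans ler01).
exists (D `^ k' * (2 `^ k' * 2 `^ k')).
  by rewrite !mulr_gt0// powR_gt0.
move=> a b u u0; set r := 1 + _ + _ => ur.
have a0 : 0 <= `|a| by []; have b0 : 0 <= `|b| by [].
have r1 : 1 <= r by rewrite /r -addrA lerDl addr_ge0.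
have Dr : 1 <= D * r by rewrite -[leLHS]mulr1 ler_pM.
apply: (@le_trans _ _ ((D * r) `^ k)).
  by apply: ge0_ler_powR; rewrite ?nnegrE//; [exact: ltW|exact: le_trans Dr].
apply: (le_trans (ler_powR Dr kk')).
rewrite powRM ?(ltW D0)//; last by rewrite (le_trans ler01).
rewrite -mulrA ler_wpM2l ?powR_ge0// /r -addrA.
apply: (le_trans (powR_add_le k'0 ler01 (addr_ge0 a0 b0))).
rewrite -mulrA ler_wpM2l ?powR_ge0// powR1 mulrDr mulr1 /lyap /= mul1r.
apply: lerD; last exact: powR_add_le.
by rewrite -[leLHS](powRr0 2) ler_powR// ler1n.
Qed.

(** * Ergodicity and moments of the network *)

Lemma network_semigroup_drift (R : realType) (a : network R) (L : limits R)
    (c K C1 k beta : R) n (p : R -> R.-pker state ~> state) :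
  rates_ge0 a -> 0 < c -> 0 <= C1 -> 1 <= k -> 0 < beta -> regime a L c K n ->
  (forall x, genhat a L n (lyap k beta) x <= C1 - c * lyap k beta (xhat L n x)) ->
  transition_semigroup (gen a L n) p ->
  forall f, bnd f -> (forall x, f x <= lyap k beta (xhat L n x)) ->
  forall t x, 0 <= t ->
  Et p t f x <= expR (- c * t) * lyap k beta (xhat L n x) + C1 / c.
Proof.
move=> ra c0 C10 k1 b0 rg dr hp f bf fV t x t0.
apply: (Et_drift hp (gen_jump_generator L n ra) C10 c0 _ dr bf fV) => //.
exact: (lyap_sublevel_finite L (rg_n rg) k1 b0).
Qed.

Lemma network_geometrically_ergodic (R : realType) (a : network R) (L : limits R)
    (c K C1 k beta : R) n (p : R -> R.-pker state ~> state) :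
  rates_ge0 a -> 0 < c -> 0 <= C1 -> 1 <= k -> 0 < beta -> regime a L c K n ->
  (forall x, genhat a L n (lyap k beta) x <= C1 - c * lyap k beta (xhat L n x)) ->
  transition_semigroup (gen a L n) p -> geometrically_ergodic p.
Proof.
move=> ra c0 C10 k1 b0 rg dr hp.
apply: (harris_geometrically_ergodic hp (V := fun x => lyap k beta (xhat L n x))
  (K := C1 / c) (C2 := c) (z := (0%N, 0%N))) => //.
- by move=> x; exact: lyap_ge0.
- by rewrite divr_ge0// ltW.
- exact: (lyap_sublevel_finite L (rg_n rg) k1 b0).
- exact: (network_semigroup_drift ra c0 C10 k1 b0 rg dr hp).
- by move=> t x t0; exact: (hit_empty_gt0 ra c0 rg hp).
Qed.

Lemma cvg_pair_bounded (R : realType) (u : nat -> R * R) (l : R * R) :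
  u n @[n --> \oo] --> l ->
  exists2 M : R, 0 <= M & \forall n \near \oo, `|(u n).1| <= M /\ `|(u n).2| <= M.
Proof.
move=> ul.
have u1 : (u n).1 @[n --> \oo] --> l.1 by apply: (cvg_comp u fst ul); exact: cvg_fst.
have u2 : (u n).2 @[n --> \oo] --> l.2 by apply: (cvg_comp u snd ul); exact: cvg_snd.
have [M1 M10 H1] := cvg_norm_bounded u1; have [M2 M20 H2] := cvg_norm_bounded u2.
exists (M1 + M2); first exact: addr_ge0.
near=> n; split.
  by apply: (@le_trans _ _ M1); [near: n|rewrite lerDl].
by apply: (@le_trans _ _ M2); [near: n|rewrite lerDr].
Unshelve. all: by end_near. Qed.

Lemma ergodic_mean_ge0 (R : realType) d (T : measurableType d) (P : probability T R)
    (g : R -> T -> R) : (forall s w, 0 <= g s w) -> (0 <= ergodic_mean P g)%E.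
Proof.
move=> g0; apply: limf_esup_ge0; first exact: filter_not_empty.
move=> S; have [S0|S0] := leP 0 S.
  rewrite mule_ge0 ?lee_fin ?invr_ge0//; apply: integral_ge0 => w _.
  by apply: integral_ge0 => s _; rewrite lee_fin.
rewrite integral0_eq ?mule0// => w _.
by rewrite set_itv_ge ?integral_set0// bnd_simp -ltNge.
Qed.

(** A single Lyapunov function, of degree at least k, controls the state, the
    queues and the idle servers; its constants are those of the regime, and n
    enters only through its value at the initial state, which stays bounded. *)
Lemma uniform_moments (R : realType) (a : network R) (L : limits R)
    (hHW : halfin_whitt a L)
    (hgam1 : 0 < lgam1 L) (hgam2 : 0 < lgam2 L)
    (p : nat -> R -> R.-pker state ~> state)
    (hp : forall n, transition_semigroup (gen a L n) (p n))
    (d : nat -> measure_display) (T : forall n, measurableType (d n))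
    (P : forall n, probability (T n) R)
    (X : forall n, R -> T n -> state)
    (hX : forall n, markov_process (p n) (P n) (X n))
    (x0 : nat -> state) (hx0 : forall n w, X n 0 w = x0 n)
    (xinf : R * R) (hxinf : xhat L n (x0 n) @[n --> \oo] --> xinf) (k : R) :
  0 < k -> exists (n0 : nat) (B : R), forall n, (n0 <= n)%N ->
  forall (g : state -> R) (D : R), 0 < D ->
  (forall x, 0 <= g x <= D * (enorm (xhat L n x) `^ k + enorm (qhat a L n x) `^ k
     + enorm (yhat a L n x) `^ k)) ->
  (ergodic_mean (P n) (fun s w => g (X n s w)) <= (D * B)%:E)%E.
Proof.
move=> k0.
(* Small powers are dominated by the Lyapunov function of degree 2. *)
set k' := Num.max k 2.
have kk' : k <= k' by rewrite le_max lexx.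
have k'2 : 2 <= k' by rewrite le_max lexx orbT.
have k'1 : 1 <= k' by rewrite (le_trans _ k'2)// ler1n.
have [c [K [c0 cK [n1 rg]]]] := regime_near hHW hgam1 hgam2.
have K0 : 0 <= K by rewrite (le_trans (ltW c0)).
have [C1 C10 drift] := lyapunov_drift k'2 c0 cK (ltr01 : 0 < (1 : R)).
have D1 : 1 <= 3 + 3 * K by lra.
have [G G0 HG] := growth_power k0 kk' k'1 D1.
have [M M0 [n2 _ HM]] := cvg_pair_bounded hxinf.
pose V0 := M `^ k' + M `^ k'.
exists (maxn n1 n2), (3 * G * (1 + V0 + C1 / c)) => n.
rewrite geq_max => /andP[nn1 nn2] g D D0 gD.
have {}rg := rg n nn1.
pose V x := lyap k' 1 (xhat L n x).
have Vge0 x : 0 <= V x by exact: lyap_ge0.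
have gV x : 0 <= g x <= 3 * G * D * (1 + V x).
  have /andP[-> gx] /= := gD x; apply: (le_trans gx).
  have [h1 h2 h3] := queue_idle_growth x rg K0.
  have H u : 0 <= u -> u <= _ -> _ := HG (xhat L n x).1 (xhat L n x).2 u.
  have {}h1 := H _ (sqrtr_ge0 _) h1; have {}h2 := H _ (sqrtr_ge0 _) h2.
  have {}h3 := H _ (sqrtr_ge0 _) h3.
  rewrite (_ : 3 * G * D * (1 + V x)
    = D * (G * (1 + V x) + G * (1 + V x) + G * (1 + V x))); last by ring.
  rewrite -surjective_pairing -/(V x) in h1 h2 h3.
  by rewrite ler_wpM2l ?(ltW D0)//; apply: lerD => //; exact: lerD.
have Vd := network_semigroup_drift (hw_rates hHW) c0 (ltW C10) k'1 ltr01
  rg (drift a L n rg) (hp n).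
have GD0 : 0 < 3 * G * D by rewrite !mulr_gt0.
have mom := moment_bound c0 Vge0 Vd GD0 gV.
have Vx0 : V (x0 n) <= V0.
  have [h1 h2] := HM n nn2; rewrite /V /lyap mul1r /V0.
  by apply: lerD; apply: ge0_ler_powR; rewrite ?nnegrE// (le_trans ler01).
apply: ergodic_mean_le => S S0.
have -> : D * (3 * G * (1 + V0 + C1 / c)) = 3 * G * D * (1 + V0 + C1 / c) by ring.
have Cc : 0 <= C1 / c by rewrite divr_ge0// ltW.
apply: (time_average_le (hX n) (hx0 n)) => //.
- by move=> x; case/andP: (gV x).
- by rewrite mulr_ge0 ?(ltW GD0)// !addr_ge0// powR_ge0.
- move=> t t0; apply: (le_trans (mom t (x0 n) t0)).
  by rewrite lee_fin ler_wpM2l ?(ltW GD0)// lerD2r lerD2l.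
Qed.

Lemma weighted_sum_le (R : realType) (a b c d e u v : R) :
  0 <= a -> 0 <= b -> 0 <= c -> 0 <= d -> 0 <= e -> 0 <= u -> 0 <= v ->
  a * u + b * u + (c * v + d * v) <= (a + b + (c + d)) * (e + u + v).
Proof.
move=> a0 b0 c0 d0 e0 u0 v0.
have ab0 : 0 <= a + b by rewrite addr_ge0.
have cd0 : 0 <= c + d by rewrite addr_ge0.
rewrite -!mulrDl [leRHS]mulrDl; apply: lerD; apply: ler_wpM2l => //.
  by rewrite addrAC lerDr addr_ge0.
by rewrite lerDr addr_ge0.
Qed.

Theorem proposition3p1 (R : realType) (a : network R) (L : limits R)
    (hHW : halfin_whitt a L)
    (hgam1 : 0 < lgam1 L) (hgam2 : 0 < lgam2 L)
    (p : nat -> R -> R.-pker state ~> state)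
    (hp : forall n, transition_semigroup (gen a L n) (p n))
    (d : nat -> measure_display) (T : forall n, measurableType (d n))
    (P : forall n, probability (T n) R)
    (X : forall n, R -> T n -> state)
    (hX : forall n, markov_process (p n) (P n) (X n))
    (x0 : nat -> state) (hx0 : forall n w, X n 0 w = x0 n)
    (xinf : R * R) (hxinf : xhat L n (x0 n) @[n --> \oo] --> xinf) :
  (forall k : R, 2 <= k ->
    exists beta0 : R, 0 < beta0 /\
      forall beta : R, beta0 <= beta ->
        exists (C1 C2 : R) (n0 : nat),
          [/\ 0 < C1, 0 < C2,
              forall n, (n0 <= n)%N -> forall x : state,
                genhat a L n (lyap k beta) x
                  <= C1 - C2 * lyap k beta (xhat L n x) &
              forall n, (n0 <= n)%N -> geometrically_ergodic (p n)])
  /\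
  (forall k : R, 0 < k ->
    exists n0 : nat,
      [/\ (ereal_sup [set ergodic_mean (P n)
              (fun s w => (enorm (xhat L n (X n s w)) `^ k)%R)
                | n in [set n | (n0 <= n)%N]] < +oo)%E,
          (ereal_sup [set ergodic_mean (P n)
              (fun s w => (enorm (qhat a L n (X n s w)) `^ k)%R)
                | n in [set n | (n0 <= n)%N]] < +oo)%E &
          (ereal_sup [set ergodic_mean (P n)
              (fun s w => (enorm (yhat a L n (X n s w)) `^ k)%R)
                | n in [set n | (n0 <= n)%N]] < +oo)%E])
  /\
  (forall (m : R) (xi zeta : R * R), 1 <= m ->
    0 < xi.1 -> 0 < xi.2 -> 0 <= zeta.1 -> 0 <= zeta.2 ->
    exists n0 : nat, forall n, (n0 <= n)%N ->
      ergodic_mean (P n) (fun s w =>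
        running_cost m xi zeta (qhat a L n (X n s w)) (yhat a L n (X n s w)))
        \is a fin_num).
Proof.
have moments := uniform_moments hHW hgam1 hgam2 hp hX hx0 hxinf.
split; [|split].
- move=> k k2; exists 1; split => // beta b1.
  have b0 : 0 < beta by rewrite (lt_le_trans ltr01).
  have k1 : 1 <= k by rewrite (le_trans _ k2)// ler1n.
  have [c [K [c0 cK [n0 rg]]]] := regime_near hHW hgam1 hgam2.
  have [C1 C10 drift] := lyapunov_drift k2 c0 cK b0.
  exists C1, c, n0; split => //.
    by move=> n /rg rgn x; exact: drift.
  move=> n /rg rgn; apply: (network_geometrically_ergodic _ c0 (ltW C10) k1 b0 rgn
    (drift a L n rgn) (hp n)).
  exact: hw_rates hHW.
- move=> k k0; have [n0 [B HB]] := moments k k0; exists n0.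
  have fin (g : forall n, state -> R) : (forall n x, 0 <= g n x <=
      1 * (enorm (xhat L n x) `^ k + enorm (qhat a L n x) `^ k
        + enorm (yhat a L n x) `^ k)) ->
      (ereal_sup [set ergodic_mean (P n) (fun s w => g n (X n s w))
        | n in [set n | (n0 <= n)%N]] < +oo)%E.
    move=> gle; apply: (@le_lt_trans _ _ (1 * B)%:E); last exact: ltry.
    by apply: ub_ereal_sup => _ [n /= nn0 <-]; apply: HB => //; exact: gle.
  split.
  + apply: (fin (fun n x => enorm (xhat L n x) `^ k)) => n x.
    by rewrite powR_ge0 mul1r -addrA lerDl addr_ge0// powR_ge0.
  + apply: (fin (fun n x => enorm (qhat a L n x) `^ k)) => n x.
    by rewrite powR_ge0 mul1r addrAC lerDr addr_ge0// powR_ge0.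
  + apply: (fin (fun n x => enorm (yhat a L n x) `^ k)) => n x.
    by rewrite powR_ge0 mul1r lerDr addr_ge0// powR_ge0.
- move=> m xi zeta m1 xi1 xi2 z1 z2.
  have m0 : 0 < m by rewrite (lt_le_trans ltr01).
  have [n0 [B HB]] := moments m m0; exists n0 => n nn0.
  pose D := xi.1 + xi.2 + (zeta.1 + zeta.2).
  have D0 : 0 < D by rewrite ltr_pwDl ?addr_gt0// addr_ge0.
  have cost0 x : 0 <= running_cost m xi zeta (qhat a L n x) (yhat a L n x).
    by rewrite /running_cost !addr_ge0// mulr_ge0 ?powR_ge0// ltW.
  rewrite ge0_fin_numE; last by apply: ergodic_mean_ge0 => s w; exact: cost0.
  apply: (@le_lt_trans _ _ (D * B)%:E); last exact: ltry.
  apply: (HB n nn0 (fun x => running_cost m xi zeta (qhat a L n x) (yhat a L n x)) D D0).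
  move=> x; rewrite cost0 /= /running_cost.
  set e := enorm (xhat L n x) `^ m; set eq := enorm (qhat a L n x) `^ m.
  set ey := enorm (yhat a L n x) `^ m.
  have e0 : 0 <= e by exact: powR_ge0.
  have eq0 : 0 <= eq by exact: powR_ge0.
  have ey0 : 0 <= ey by exact: powR_ge0.
  have mono (u v : R) : 0 <= u -> `|u| <= v -> u `^ m <= v `^ m.
    move=> u0 uv; apply: ge0_ler_powR; rewrite ?nnegrE ?(ltW m0)//.
      exact: le_trans uv.
    by rewrite -[u]ger0_norm.
  have pos (j : nat) : 0 <= j%:R / Num.sqrt n%:R :> R by rewrite divr_ge0// sqrtr_ge0.
  have h1 := mono _ _ (pos _) (fst_le_enorm (qhat a L n x)).
  have h2 := mono _ _ (pos _) (snd_le_enorm (qhat a L n x)).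
  have h3 := mono _ _ (pos _) (fst_le_enorm (yhat a L n x)).
  have h4 := mono _ _ (pos _) (snd_le_enorm (yhat a L n x)).
  have {}h1 := ler_wpM2l (ltW xi1) h1; have {}h2 := ler_wpM2l (ltW xi2) h2.
  have {}h3 := ler_wpM2l z1 h3; have {}h4 := ler_wpM2l z2 h4.
  apply: (le_trans (lerD (lerD h1 h2) (lerD h3 h4))).
  exact: weighted_sum_le (ltW xi1) (ltW xi2) z1 z2 e0 eq0 ey0.
Qed.
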